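(* (a) The group $G=\langle a,b,t\mid b^{-1}ab=a^2,\ [a,t]=1\rangle$ is highly transitive and mixed identity free, but not acylindrically hyperbolic. (b) There exist finitely generated mixed identity free groups of transitivity degree $1$.
   Context: An action of a group $G$ on a set $\Omega$ is $k$-transitive if $|\Omega|\ge k$ and for any two $k$-tuples of distinct elements $(a_1,\dots,a_k)$, $(b_1,\dots,b_k)$ of $\Omega$ there is $g\in G$ with $ga_i=b_i$ for all $i$; it is highly transitive if it is $k$-transitive for all $k\in\mathbb N$. A group is highly transitive if it admits a highly transitive faithful action. The transitivity degree of a countable group $G$ is the supremum of all $k\in\mathbb N$ such that $G$ admits a $k$-transitive faithful action. An isometric action of $G$ on a metric space $(X,d)$ is acylindrical if for every $\varepsilon>0$ there exist $R,N>0$ such that for all $x,y\in X$ with $d(x,y)\ge R$ there are at most $N$ elements $g\in G$ with $d(x,gx)\le\varepsilon$ and $d(y,gy)\le\varepsilon$. A group is acylindrically hyperbolic if it is not virtually cyclic and admits an acylindrical action on a hyperbolic metric space with unbounded orbits. Let $F_n$ be the free group of rank $n$. A group $G$ satisfies a mixed identity $w=1$, $w\in G\ast F_n$, if every homomorphism $G\ast F_n\to G$ that is the identity on $G$ sends $w$ to $1$; it is non-trivial if $w\ne1$ in $G\ast F_n$. $G$ is mixed identity free if it satisfies no non-trivial mixed identity (for any $n$). *)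

(* Defs.v *)
From HB Require Import structures.
From mathcomp Require Import all_boot all_order all_algebra.
From mathcomp Require Import all_classical all_reals all_analysis.

Set Implicit Arguments.
Unset Strict Implicit.
Unset Printing Implicit Defensive.

Import Order.TTheory GRing.Theory Num.Theory.

Local Open Scope classical_set_scope.
Local Open Scope quotient_scope.

Section Subgroups.
Local Open Scope group_scope.
Variable G : groupType.
Implicit Types (H S : set G) (x : G).

Definition is_subgroup H : Prop :=
  H 1 /\ (forall x y, H x -> H y -> H (x * y^-1)).

Definition is_normal_subgroup H : Prop :=
  is_subgroup H /\ (forall x y, H x -> H (x ^ y)).

Definition generated S : set G := smallest is_subgroup S.

Definition normal_closure S : set G := smallest is_normal_subgroup S.

Definition finitely_generated : Prop :=
  exists s : seq G, generated [set` s] = [set: G].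

Definition left_coset x H : set G := [set x * h | h in H].

Definition finite_index H : Prop :=
  finite_set [set left_coset x H | x in [set: G]].

Definition virtually_cyclic : Prop :=
  exists x : G, finite_index (generated [set x]).

Lemma normal_closureP S : is_normal_subgroup (normal_closure S).
Proof.
split; first split.
- by move=> H [[[H1 _] _] _].
- by move=> x y Sx Sy H HS; case: (HS) => -[[_ Hd] _] _; apply: Hd;
    [exact: Sx | exact: Sy].
- by move=> x y Sx H HS; case: (HS) => -[_ Hj] _; apply: Hj; exact: Sx.
Qed.

End Subgroups.

(* A letter (x, true) stands for x and (x, false) for its formal inverse. *)
Section FreeGroup.
Variable X : choiceType.
Implicit Types u v w : seq (X * bool).

Inductive free_eq : seq (X * bool) -> seq (X * bool) -> Prop :=
| FreeCancel u v x e : free_eq (u ++ (x, e) :: (x, ~~ e) :: v) (u ++ v)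
| FreeRefl u : free_eq u u
| FreeSym u v : free_eq u v -> free_eq v u
| FreeTrans u v w : free_eq u v -> free_eq v w -> free_eq u w.

Definition free_eqb : rel (seq (X * bool)) := fun u v => `[< free_eq u v >].

Fact free_eqb_refl : reflexive free_eqb.
Proof. by move=> u; apply/asboolP; exact: FreeRefl. Qed.
Fact free_eqb_sym : symmetric free_eqb.
Proof. by move=> u v; apply/asboolP/asboolP; exact: FreeSym. Qed.
Fact free_eqb_trans : transitive free_eqb.
Proof.
by move=> v u w /asboolP uv /asboolP vw; apply/asboolP; exact: FreeTrans uv vw.
Qed.

Canonical free_equiv :=
  EquivRel free_eqb free_eqb_refl free_eqb_sym free_eqb_trans.

Definition free_group : Type := {eq_quot free_equiv}.
HB.instance Definition _ := Choice.on free_group.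
HB.instance Definition _ := Quotient.on free_group.

Definition free_class u : free_group := \pi_free_group u.

Definition winv u : seq (X * bool) := rev [seq (p.1, ~~ p.2) | p <- u].

Lemma free_classP u v : free_class u = free_class v <-> free_eq u v.
Proof.
rewrite /free_class; split => [/eqmodP/asboolP // | uv].
by apply/eqmodP/asboolP.
Qed.

Lemma free_eq_catl u v w : free_eq u v -> free_eq (w ++ u) (w ++ v).
Proof.
elim=> [a b x e|a|a b _ IH|a b c _ IH1 _ IH2].
- by rewrite catA (catA w a b); exact: FreeCancel.
- exact: FreeRefl.
- exact: FreeSym.
- exact: FreeTrans IH1 IH2.
Qed.

Lemma free_eq_catr u v w : free_eq u v -> free_eq (u ++ w) (v ++ w).
Proof.
elim=> [a b x e|a|a b _ IH|a b c _ IH1 _ IH2].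
- by rewrite -!catA; exact: FreeCancel.
- exact: FreeRefl.
- exact: FreeSym.
- exact: FreeTrans IH1 IH2.
Qed.

Lemma free_eq_winv u v : free_eq u v -> free_eq (winv u) (winv v).
Proof.
elim=> [a b x e|a|a b _ IH|a b c _ IH1 _ IH2].
- rewrite /winv !map_cat /= !rev_cat !rev_cons -!cats1 -!catA /= negbK.
  exact: FreeCancel.
- exact: FreeRefl.
- exact: FreeSym.
- exact: FreeTrans IH1 IH2.
Qed.

Lemma free_eq_winvl u : free_eq (winv u ++ u) [::].
Proof.
elim: u => [|[x e] u IH] /=; first exact: FreeRefl.
rewrite /winv /= rev_cons -cats1 -catA /=.
apply: FreeTrans IH; rewrite -/(winv u).
by have := FreeCancel (winv u) u x (~~ e); rewrite negbK.
Qed.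

Lemma winvK : involutive winv.
Proof.
move=> u; rewrite /winv map_rev revK -map_comp.
by rewrite -[RHS]map_id; apply: eq_map => -[x e] /=; rewrite negbK.
Qed.

Definition free_one : free_group := free_class [::].
Definition free_mul (p q : free_group) : free_group :=
  free_class (repr p ++ repr q).
Definition free_inv (p : free_group) : free_group := free_class (winv (repr p)).

Lemma free_classK p : free_class (repr p) = p.
Proof. exact: reprK. Qed.

Lemma free_classM u v : free_mul (free_class u) (free_class v)
  = free_class (u ++ v).
Proof.
apply/free_classP; apply: (@FreeTrans _ (repr (free_class u) ++ v)).
  by apply: free_eq_catl; apply/free_classP; rewrite free_classK.
by apply: free_eq_catr; apply/free_classP; rewrite free_classK.
Qed.

Lemma free_classV u : free_inv (free_class u) = free_class (winv u).
Proof.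
by apply/free_classP/free_eq_winv/free_classP; rewrite free_classK.
Qed.

Fact free_mulA : associative free_mul.
Proof.
move=> p q r; rewrite -(free_classK p) -(free_classK q) -(free_classK r).
by rewrite !free_classM catA.
Qed.
Fact free_mul1g : left_id free_one free_mul.
Proof. by move=> p; rewrite -(free_classK p) free_classM. Qed.
Fact free_mulg1 : right_id free_one free_mul.
Proof. by move=> p; rewrite -(free_classK p) free_classM cats0. Qed.
Fact free_mulVg : left_inverse free_one free_inv free_mul.
Proof.
move=> p; rewrite -(free_classK p) free_classV free_classM.
by apply/free_classP; exact: free_eq_winvl.
Qed.
Fact free_mulgV : right_inverse free_one free_inv free_mul.
Proof.
move=> p; rewrite -(free_classK p) free_classV free_classM.
by apply/free_classP; rewrite -{1}(winvK (repr p)); exact: free_eq_winvl.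
Qed.

HB.instance Definition _ := isGroup.Build free_group
  free_mulA free_mul1g free_mulg1 free_mulVg free_mulgV.

Definition free_gen (x : X) : free_group := free_class [:: (x, true)].

End FreeGroup.

Arguments free_gen {X}.

Section Presentation.
Local Open Scope group_scope.
Variables (X : choiceType) (rels : set (free_group X)).

Definition pres_eqb : rel (free_group X) :=
  fun p q => `[< normal_closure rels (p^-1 * q) >].

Let N1 : normal_closure rels 1.
Proof. by case: (normal_closureP rels) => -[]. Qed.
Let ND x y : normal_closure rels x -> normal_closure rels y ->
  normal_closure rels (x * y^-1).
Proof. by case: (normal_closureP rels) => -[_ Hd] _; exact: Hd. Qed.
Let NJ x y : normal_closure rels x -> normal_closure rels (x ^ y).
Proof. by case: (normal_closureP rels) => _; exact. Qed.
Let NV x : normal_closure rels x -> normal_closure rels x^-1.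
Proof. by move=> Nx; have := ND N1 Nx; rewrite mul1g. Qed.
Let NM x y : normal_closure rels x -> normal_closure rels y ->
  normal_closure rels (x * y).
Proof. by move=> Nx Ny; have := ND Nx (NV Ny); rewrite invgK. Qed.

Fact pres_eqb_refl : reflexive pres_eqb.
Proof. by move=> p; apply/asboolP; rewrite mulVg. Qed.
Fact pres_eqb_sym : symmetric pres_eqb.
Proof.
by move=> p q; apply/asboolP/asboolP => /NV; rewrite invgM invgK.
Qed.
Fact pres_eqb_trans : transitive pres_eqb.
Proof.
move=> q p r /asboolP pq /asboolP qr; apply/asboolP.
by have := NM pq qr; rewrite -mulgA mulVKg.
Qed.

Canonical pres_equiv :=
  EquivRel pres_eqb pres_eqb_refl pres_eqb_sym pres_eqb_trans.

(* < X | rels >: the free group on X modulo the normal closure of rels *)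
Definition presented_group : Type := {eq_quot pres_equiv}.
HB.instance Definition _ := Choice.on presented_group.
HB.instance Definition _ := Quotient.on presented_group.

Definition pres_class (p : free_group X) : presented_group :=
  \pi_presented_group p.

Lemma pres_classP p q :
  pres_class p = pres_class q <-> normal_closure rels (p^-1 * q).
Proof.
rewrite /pres_class; split => [/eqmodP/asboolP // | pq].
by apply/eqmodP/asboolP.
Qed.

Lemma pres_classK p : pres_class (repr p) = p.
Proof. exact: reprK. Qed.

Definition pres_one : presented_group := pres_class 1.
Definition pres_mul (p q : presented_group) : presented_group :=
  pres_class (repr p * repr q).
Definition pres_inv (p : presented_group) : presented_group :=
  pres_class (repr p)^-1.

Lemma pres_mulE p q : pres_mul (pres_class p) (pres_class q)
  = pres_class (p * q).
Proof.
apply/pres_classP; set p' := repr _; set q' := repr _.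
have /pres_classP Np : pres_class p' = pres_class p by rewrite pres_classK.
have /pres_classP Nq : pres_class q' = pres_class q by rewrite pres_classK.
have -> : (p' * q')^-1 * (p * q) = (p'^-1 * p) ^ q' * (q'^-1 * q).
  by rewrite /conjg invgM !mulgA mulgK.
by apply: NM Nq; exact: NJ.
Qed.

Lemma pres_invE p : pres_inv (pres_class p) = pres_class p^-1.
Proof.
apply/pres_classP; set p' := repr _.
have /pres_classP Np : pres_class p' = pres_class p by rewrite pres_classK.
have -> : p'^-1^-1 * p^-1 = ((p'^-1 * p)^-1) ^ p^-1.
  by rewrite /conjg invgM !invgK !mulgA mulgV mul1g.
by apply: NJ; exact: NV.
Qed.

Fact pres_mulA : associative pres_mul.
Proof.
move=> p q r; rewrite -(pres_classK p) -(pres_classK q) -(pres_classK r).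
by rewrite !pres_mulE mulgA.
Qed.
Fact pres_mul1g : left_id pres_one pres_mul.
Proof. by move=> p; rewrite -(pres_classK p) pres_mulE mul1g. Qed.
Fact pres_mulg1 : right_id pres_one pres_mul.
Proof. by move=> p; rewrite -(pres_classK p) pres_mulE mulg1. Qed.
Fact pres_mulVg : left_inverse pres_one pres_inv pres_mul.
Proof. by move=> p; rewrite -(pres_classK p) pres_invE pres_mulE mulVg. Qed.
Fact pres_mulgV : right_inverse pres_one pres_inv pres_mul.
Proof. by move=> p; rewrite -(pres_classK p) pres_invE pres_mulE mulgV. Qed.

HB.instance Definition _ := isGroup.Build presented_group
  pres_mulA pres_mul1g pres_mulg1 pres_mulVg pres_mulgV.

End Presentation.

Section FreeProduct.
Local Open Scope group_scope.
Variables G H : groupType.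

(* The multiplication tables of G and H, read in the free group on the
   disjoint union of G and H. *)
Definition free_product_rels : set (free_group (G + H)%type) :=
  [set w | (exists x y : G, w = free_gen (inl x) * free_gen (inl y)
                                / free_gen (inl (x * y)))
        \/ (exists x y : H, w = free_gen (inr x) * free_gen (inr y)
                                / free_gen (inr (x * y)))].

Definition free_product : Type := presented_group free_product_rels.
HB.instance Definition _ := Group.on free_product.

Definition free_product_inl (x : G) : free_product :=
  pres_class free_product_rels (free_gen (inl x)).

End FreeProduct.

Section MixedIdentities.
Local Open Scope group_scope.
Variable G : groupType.

Definition satisfies_mixed_identity n
    (w : free_product G (free_group 'I_n)) : Prop :=
  forall f : UMagmaMorphism.type (free_product G (free_group 'I_n)) G,
    (forall x : G, f (free_product_inl (free_group 'I_n) x) = x) -> f w = 1.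

Definition mixed_identity_free : Prop :=
  forall n (w : free_product G (free_group 'I_n)),
    w <> 1 -> ~ satisfies_mixed_identity w.

End MixedIdentities.

Section Actions.
Variables (G : groupType) (T : Type).
Implicit Type act : G -> T -> T.

Definition is_group_action act : Prop :=
  (forall x, act 1%g x = x) /\
  (forall g h x, act (g * h)%g x = act g (act h x)).

Definition faithful_action act : Prop :=
  forall g, (forall x, act g x = x) -> g = 1%g.

Definition k_transitive k act : Prop :=
  ([set: 'I_k] #<= [set: T])%card /\
  (forall a b : 'I_k -> T, injective a -> injective b ->
     exists g, forall i, act g (a i) = b i).

Definition highly_transitive_action act : Prop :=
  forall k, k_transitive k act.

End Actions.

Definition highly_transitive (G : groupType) : Prop :=
  exists (T : Type) (act : G -> T -> T),
    [/\ is_group_action act, faithful_action act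
      & highly_transitive_action act].

Definition has_faithful_k_transitive_action (G : groupType) (k : nat) : Prop :=
  exists (T : Type) (act : G -> T -> T),
    [/\ is_group_action act, faithful_action act & k_transitive k act].

Definition transitivity_degree (R : realType) (G : groupType) : \bar R :=
  ereal_sup [set (k%:R)%:E | k in [set k | has_faithful_k_transitive_action G k]].

Section Hyperbolicity.
Local Open Scope ring_scope.
Variables (R : realType) (X : metricType R).
Implicit Types (x y z : X) (S : set X).

Definition geodesic_segment x y S : Prop :=
  exists c : R -> X,
    [/\ c 0 = x, c (mdist x y) = y,
        {in `[0, mdist x y] &, forall s t, mdist (c s) (c t) = `|s - t|}
      & S = c @` `[0, mdist x y]].

Definition geodesic_space : Prop := forall x y, exists S, geodesic_segment x y S.

Definition slim_triangles (delta : R) : Prop :=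
  forall x y z Sxy Syz Sxz, geodesic_segment x y Sxy ->
    geodesic_segment y z Syz -> geodesic_segment x z Sxz ->
    forall p, Sxy p -> exists2 q, (Syz `|` Sxz) q & mdist p q <= delta.

(* Geodesicity is part of the definition: it cannot be dropped, since every
   metric d yields a metric log(1 + d) satisfying the four-point condition. *)
Definition hyperbolic_space : Prop :=
  geodesic_space /\ exists2 delta : R, 0 <= delta & slim_triangles delta.

Definition metrically_bounded S : Prop :=
  exists M : R, forall x y, S x -> S y -> mdist x y <= M.

Variables (G : groupType) (act : G -> X -> X).

Definition isometric_action : Prop :=
  is_group_action act /\
  (forall g x y, mdist (act g x) (act g y) = mdist x y).

(* `I_N = {0, ..., N - 1} *)
Definition acylindrical_action : Prop :=
  isometric_action /\
  forall eps : R, 0 < eps -> exists (r : R) (N : nat), [/\ 0 < r, (0 < N)%N &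
    forall x y, r <= mdist x y ->
      ([set g | mdist x (act g x) <= eps /\ mdist y (act g y) <= eps]
         #<= `I_N)%card].

(* X must be nonempty, otherwise the orbit condition is vacuous. *)
Definition unbounded_orbits : Prop :=
  [set: X] !=set0 /\
  forall x, ~ metrically_bounded [set act g x | g in [set: G]].

End Hyperbolicity.

Definition acylindrically_hyperbolic (R : realType) (G : groupType) : Prop :=
  ~ virtually_cyclic G /\
  exists (X : metricType R) (act : G -> X -> X),
    [/\ hyperbolic_space X, acylindrical_action act & unbounded_orbits act].

Section TheGroup.
Local Open Scope group_scope.

Definition abt_a : free_group 'I_3 := free_gen (@Ordinal 3 0 isT).
Definition abt_b : free_group 'I_3 := free_gen (@Ordinal 3 1 isT).
Definition abt_t : free_group 'I_3 := free_gen (@Ordinal 3 2 isT).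

(* < a, b, t | b^-1 a b = a^2, [a, t] = 1 > *)
Definition abt_rels : set (free_group 'I_3) :=
  [set abt_b^-1 * abt_a * abt_b / abt_a ^+ 2; [~ abt_a, abt_t]].

Definition abt_group : Type := presented_group abt_rels.
HB.instance Definition _ := Group.on abt_group.

End TheGroup.

(* Main.v *)
Require Import Defs.
From HB Require Import structures.
From mathcomp Require Import all_boot all_order all_algebra.
From mathcomp Require Import all_classical all_reals all_analysis.
From mathcomp Require Import ring lra zify.

(** In part (a), write G for < a, b, t | b^-1 a b = a^2, [a, t] = 1 >.

G is highly transitive.  In the left regular action of G on itself, t may be
replaced by any permutation of the set G that commutes with left translation
by a: the defining relations still hold.  Given finitely many distinct points
x_i and distinct points y_i, a high power b^N moves the x_i into pairwise
different orbits of < a >, because conjugation by b halves exponents of a.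
Hence t can be modified so as to send b^N x_i to b^N' y_i, and then
b^-N' t b^N sends x_i to y_i.  There are countably many such tasks; the
homomorphism to Z counting b assigns to each point a height, and N, N' are
chosen so that different tasks modify t in disjoint windows of nonnegative
heights.  This is
abt_highly_transitive_action.

G is mixed identity free.  At points of very negative height the new action of
a given g is still left translation, so every g <> 1 moves infinitely many
points.  A highly transitive action with that property forbids mixed
identities (highly_transitive_mixed_identity_free): follow a point along a
reduced mixed word, choosing the values of the variables so that the
trajectory visits new points only; finitely many values of a variable are
realized by one group element.

G is not acylindrically hyperbolic.  The subgroup < a > is commensurated, and
the displacement f of the powers of a satisfies f(2n) <= f(n) + const.  If f is
bounded, then for every g infinitely many powers of a move both x and g x by a
bounded amount.  If f is unbounded, hyperbolicity and the inequality on f(2n)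
force f(n - j) to be close to f(n) for n large compared with j, so a, a^2, ...
move all points deep inside a geodesic from x to a^n x by a bounded amount.
Both cases contradict acylindricity
(distorted_commensurated_not_acylindrically_hyperbolic).

For part (b), take letters x_i indexed by the integers, and power series over F_3
in these noncommuting letters, modulo the words having a factor that is longer
than 1 + the spread of its indices.  The group is generated by 1 + x_0 and the
translation of indices.  It is N extended by Z, where N consists of series with
constant term 1.  Finitely many letters admit finitely many surviving words, so
N is locally a finite 3-group.  On the other hand, words in which letters far
from each other alternate survive.  Substituting (1 + x_M)(1 + x_M') with
distinct distant M, M' for each variable of a reduced mixed word produces a
surviving word with a nonzero coefficient (far_evaluation_neq1), so there is no
mixed identity.

Finally such an extension is never 2-transitive (not_two_transitive).  Let P be
the stabilizer in N of a point x, let n in N move x, and let k fix x and send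
n x to n^-1 x.  If k lies in N, then n k is an element of odd order exchanging
two points.  Otherwise k permutes the double cosets of P with a nonzero shift,
which makes the subgroup generated by P and n minimal over P; by local
nilpotency P is then normal in it, so n x has the same stabilizer in N as x,
whence P = 1; then k^2 fixes every point, which is absurd. *)

Set Implicit Arguments.
Unset Strict Implicit.
Unset Printing Implicit Defensive.

Import Order.TTheory GRing.Theory Num.Theory.

Local Open Scope classical_set_scope.
Local Open Scope group_scope.

Section SubgroupTheory.
Variable G : groupType.
Implicit Types (S H : set G) (x y : G).

Lemma subgroup1 H : is_subgroup H -> H 1.
Proof. by case. Qed.

Lemma subgroupV H x : is_subgroup H -> H x -> H x^-1.
Proof. by move=> [H1 HF] Hx; rewrite -[x^-1]mul1g; exact: HF. Qed.

Lemma subgroupM H x y : is_subgroup H -> H x -> H y -> H (x * y).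
Proof.
by move=> sH Hx Hy; rewrite -[y]invgK; apply: sH.2 => //; exact: subgroupV.
Qed.

Lemma subgroupX H x n : is_subgroup H -> H x -> H (x ^+ n).
Proof.
move=> sH Hx; elim: n => [|n IH]; first exact: subgroup1.
by rewrite expgS; apply: subgroupM.
Qed.

Lemma generated_subgroup S : is_subgroup (generated S).
Proof.
split=> [H [[H1 _] _] //|x y Sx Sy H HS].
by case: (HS) => -[_ HF] _; apply: HF; [exact: Sx | exact: Sy].
Qed.

Lemma sub_generated S : S `<=` generated S.
Proof. by move=> x Sx H [_]; apply. Qed.

Lemma generated_min S H : is_subgroup H -> S `<=` H -> generated S `<=` H.
Proof. by move=> sH SH x; apply. Qed.

End SubgroupTheory.

Section FreeGroupMorphism.
Variables (X : choiceType) (H : groupType) (phi : X -> H).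

Definition eval_word (w : seq (X * bool)) : H :=
  foldr (fun p h => (if p.2 then phi p.1 else (phi p.1)^-1) * h) 1 w.

Lemma eval_word_cat u v : eval_word (u ++ v) = eval_word u * eval_word v.
Proof. by elim: u => [|p u IH] /=; rewrite ?mul1g // IH mulgA. Qed.

Lemma eval_word_free_eq u v : free_eq u v -> eval_word u = eval_word v.
Proof.
elim=> // [{}u {}v x e|{}u {}v w _ -> _ ->] //.
rewrite !eval_word_cat /=; congr (_ * _).
by case: e; rewrite /= ?mulVKg ?mulKg.
Qed.

Definition free_lift (p : free_group X) : H := eval_word (repr p).

Lemma free_lift_class w : free_lift (free_class w) = eval_word w.
Proof. by apply: eval_word_free_eq; apply/free_classP; rewrite free_classK. Qed.

Lemma free_lift_gen x : free_lift (free_gen x) = phi x.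
Proof. by rewrite free_lift_class /= mulg1. Qed.

Fact free_liftM : {morph free_lift : p q / p * q}.
Proof.
move=> p q; rewrite -[p]free_classK -[q]free_classK.
by rewrite [LHS](congr1 free_lift (free_classM _ _)) !free_lift_class eval_word_cat.
Qed.

Fact free_lift_group_morphism : {morph free_lift : p q / p / q}.
Proof.
move=> p q; rewrite free_liftM; congr (_ * _).
apply: (mulgI (free_lift q)); rewrite -free_liftM !mulgV.
by rewrite (free_lift_class [::]).
Qed.

HB.instance Definition _ :=
  isGroupMorphism.Build (free_group X) H free_lift free_lift_group_morphism.

End FreeGroupMorphism.

Section FreeGroupGeneration.
Variable X : choiceType.

Lemma free_group_ind (S : set (free_group X)) : is_subgroup S ->
  (forall x, S (free_gen x)) -> forall p, S p.
Proof.
move=> sS Sgen p; rewrite -[p]free_classK.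
elim: (repr p) => [|[x e] w IH]; first exact: (subgroup1 sS).
rewrite -cat1s -free_classM; apply: (subgroupM sS) => //.
case: e; first exact: Sgen.
have -> : free_class [:: (x, false)] = (free_gen x)^-1.
  by rewrite /free_gen [RHS]free_classV.
exact: subgroupV.
Qed.

End FreeGroupGeneration.

Section PresentationTheory.
Variables (X : choiceType) (rels : set (free_group X)).
Local Notation G := (presented_group rels).

Lemma pres_classM p q :
  pres_class rels (p * q) = pres_class rels p * pres_class rels q :> G.
Proof. by rewrite [RHS]pres_mulE. Qed.

Lemma pres_classV p : pres_class rels p^-1 = (pres_class rels p)^-1 :> G.
Proof. by rewrite [RHS]pres_invE. Qed.

Lemma pres_class_surj (g : G) : exists p, g = pres_class rels p.
Proof. by exists (repr g); rewrite pres_classK. Qed.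

Lemma pres_class_rel r : rels r -> pres_class rels r = 1 :> G.
Proof.
move=> rr; apply/esym; rewrite -[LHS]/(pres_class rels 1).
by apply/pres_classP; rewrite invg1 mul1g => N [_]; apply.
Qed.

Definition pres_gen (x : X) : G := pres_class rels (free_gen x).

(** Induction over words, phrased through subgroups so that inverses and
    products are dealt with once and for all. *)
Lemma presented_group_ind (S : set G) : is_subgroup S ->
  (forall x, S (pres_gen x)) -> forall g, S g.
Proof.
move=> sS Sgen g; have [p ->] := pres_class_surj g.
apply: (free_group_ind (S := [set p | S (pres_class rels p)])) => //.
split; first exact: (subgroup1 sS).
by move=> x y Sx Sy; rewrite /= pres_classM pres_classV; apply: sS.2.
Qed.

Variables (H : groupType) (phi : X -> H).
Hypothesis phi_rels : forall r, rels r -> free_lift phi r = 1.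

(** The map takes the proof that relators die as an argument, so that the
    morphism structure declared below applies to every instance. *)
Definition pres_lift_of of (forall r, rels r -> free_lift phi r = 1) :=
  fun g : G => free_lift phi (repr g).
Local Notation pres_lift := (pres_lift_of phi_rels).

Lemma pres_lift_class p : pres_lift (pres_class rels p) = free_lift phi p.
Proof.
rewrite /pres_lift_of; set q := repr _.
have /pres_classP : pres_class rels q = pres_class rels p by rewrite pres_classK.
have ker_normal : is_normal_subgroup [set r | free_lift phi r = 1].
  split; first split=> /=; first exact: gmulf1.
    by move=> x y /= ex ey; rewrite gmulfF /= ex ey divg1.
  by move=> x y /= ex; rewrite gmulfJ /= ex conj1g.
move=> /(_ [set r | free_lift phi r = 1]) /= /(_ (conj ker_normal phi_rels)).
by rewrite gmulfM gmulfV => /(canRL (mulVKg _)); rewrite mulg1.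
Qed.

Lemma pres_lift_gen x : pres_lift (pres_gen x) = phi x.
Proof. by rewrite pres_lift_class free_lift_gen. Qed.

Fact pres_lift_group_morphism : {morph pres_lift : p q / p / q}.
Proof.
move=> g h; have [p ->] := pres_class_surj g; have [q ->] := pres_class_surj h.
by rewrite -pres_classV -pres_classM !pres_lift_class gmulfF.
Qed.

HB.instance Definition _ :=
  isGroupMorphism.Build G H pres_lift pres_lift_group_morphism.

End PresentationTheory.

(** * Reduced mixed words *)

Section MixedWords.
Variable n : nat.

(** An item (i, e, g) stands for the factor X_i^e g. The coefficients and the
    variables are sent to a common target, so that the same word can be read in
    the free product and in G. *)
Fixpoint mixed_eval (G H : groupType) (iota : G -> H) (sigma : 'I_n -> H)
    (s : seq ('I_n * bool * G)) : H :=
  if s is (i, e, g) :: s' then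
    (if e then sigma i else (sigma i)^-1) * (iota g * mixed_eval iota sigma s')
  else 1.

Definition cancels_head (G : groupType) (i : 'I_n) (e : bool)
    (s : seq ('I_n * bool * G)) : bool :=
  if s is (j, e', _) :: _ then (j == i) && (e' == ~~ e) else false.

(** Only the cancellation of X_i^e with an immediately following X_i^-e through
    a trivial coefficient is forbidden. *)
Fixpoint reduced (G : groupType) (s : seq ('I_n * bool * G)) : bool :=
  if s is (i, e, g) :: s' then
    reduced s' && ((g == 1) ==> ~~ cancels_head i e s')
  else true.

Lemma mixed_eval_morph (G H K : groupType) (iota : G -> H)
    (sigma : 'I_n -> H) (f : UMagmaMorphism.type H K) s :
  f (mixed_eval iota sigma s)
  = mixed_eval (fun g => f (iota g)) (fun i => f (sigma i)) s.
Proof.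
elim: s => [|[[i e] g] s IH] /=; first exact: gmulf1.
by rewrite !gmulfM IH; case: e; rewrite ?gmulfV.
Qed.

Lemma eq_mixed_eval (G H : groupType) (iota iota' : G -> H)
    (sigma sigma' : 'I_n -> H) s : iota =1 iota' -> sigma =1 sigma' ->
  mixed_eval iota sigma s = mixed_eval iota' sigma' s.
Proof.
by move=> eqi eqs; elim: s => [|[[i e] g] s IH] //=; rewrite IH eqi eqs.
Qed.

Section ReducedForm.
Variable G : groupType.
Local Notation FP := (free_product G (free_group 'I_n)).
Local Notation rels := (@free_product_rels G (free_group 'I_n)).
Local Notation inl_ := (@free_product_inl G (free_group 'I_n)).

Definition free_product_inr (p : free_group 'I_n) : FP :=
  pres_gen rels (inr p).

Definition free_product_var (i : 'I_n) : FP := free_product_inr (free_gen i).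

Fact free_product_inlF : {morph inl_ : x y / x / y}.
Proof.
have inlM x y : inl_ (x * y) = inl_ x * inl_ y :> FP.
  symmetry; apply: divg1_eq; rewrite -[inl_ x * _ / _]/(pres_gen rels (inl x)
    * pres_gen rels (inl y) / pres_gen rels (inl (x * y))).
  rewrite /pres_gen -pres_classV -!pres_classM.
  by apply: pres_class_rel; left; exists x, y.
by move=> x y; apply: (mulIg (inl_ y)); rewrite -inlM !mulgVK.
Qed.

HB.instance Definition _ := isGroupMorphism.Build G FP inl_ free_product_inlF.

Fact free_product_inrF : {morph free_product_inr : x y / x / y}.
Proof.
have inrM x y : free_product_inr (x * y)
    = free_product_inr x * free_product_inr y.
  symmetry; apply: divg1_eq; rewrite -[_ * _ / _]/(pres_gen rels (inr x)
    * pres_gen rels (inr y) / pres_gen rels (inr (x * y))).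
  rewrite /pres_gen -pres_classV -!pres_classM.
  by apply: pres_class_rel; right; exists x, y.
by move=> x y; apply: (mulIg (free_product_inr y)); rewrite -inrM !mulgVK.
Qed.

HB.instance Definition _ :=
  isGroupMorphism.Build (free_group 'I_n) FP free_product_inr free_product_inrF.

(** The elements of this form are stable under left multiplication by
    coefficients (which merge with the first one) and by variables (which
    either cancel against the head or extend the word); the generators
    therefore preserve the set, and it contains 1. *)
Lemma reduced_form (w : FP) : exists g s, reduced s /\
  w = inl_ g * mixed_eval inl_ free_product_var s.
Proof.
pose S := [set w : FP | exists g s, reduced s /\
  w = inl_ g * mixed_eval inl_ free_product_var s].
have S_inl h x : S x -> S (inl_ h * x).
  move=> [g [s [rs ->]]]; exists (h * g), s; split=> //.
  by rewrite mulgA (@gmulfM _ _ inl_).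
have S_var i (e : bool) x : S x ->
    S ((if e then free_product_var i else (free_product_var i)^-1) * x).
  move=> [g [s [rs ->]]].
  have [/andP[/eqP -> c]|nc] := boolP ((g == 1) && cancels_head i e s).
    case: s rs c => // -[[j e'] h] s /= /andP[rs _] /andP[/eqP -> /eqP ->].
    exists h, s; split=> //; rewrite (@gmulf1 _ _ inl_) mul1g.
    by case: e => /=; rewrite ?mulVKg ?mulKg.
  exists 1, ((i, e, g) :: s); split.
    by rewrite /= rs implybE -negb_and.
  by rewrite (@gmulf1 _ _ inl_) mul1g.
pose T := [set w : FP | forall x, S x -> S (w * x) /\ S (w^-1 * x)].
have sT : is_subgroup T.
  split=> [x Sx|x y Tx Ty z Sz]; first by rewrite invg1 mul1g.
  rewrite invgF -!mulgA; split.
    by apply: (Tx _ _).1; apply: (Ty _ _).2.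
  by apply: (Ty _ _).1; apply: (Tx _ _).2.
suff Tw : T w by rewrite -[w]mulg1; apply: (Tw 1 _).1;
  exists 1, [::]; split=> //; rewrite (@gmulf1 _ _ inl_) mulg1.
apply: (presented_group_ind sT) => -[h|p].
  move=> x Sx; split; first exact: S_inl.
  rewrite -[_^-1]/((inl_ h)^-1); rewrite -(@gmulfV _ _ inl_); exact: S_inl.
apply: (free_group_ind (S := [set p | T (free_product_inr p)])) => [|i x Sx].
  split; first by rewrite /= gmulf1; exact: (subgroup1 sT).
  by move=> a b Ta Tb; rewrite /= gmulfF; apply: sT.2.
by split; [exact: (S_var i true) | exact: (S_var i false)].
Qed.

Lemma free_product_lift (sigma : 'I_n -> G) :
  exists f : UMagmaMorphism.type FP G,
    (forall x, f (inl_ x) = x) /\ (forall i, f (free_product_var i) = sigma i).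
Proof.
pose phi (x : G + free_group 'I_n) : G :=
  match x with inl g => g | inr p => free_lift sigma p end.
have phi_rels r : rels r -> free_lift phi r = 1.
  by move=> [|] [x [y ->]]; rewrite gmulfF gmulfM /= !free_lift_gen /=
    ?gmulfM mulgV.
exists (pres_lift_of phi_rels : UMagmaMorphism.type _ _).
split=> [x|i]; first exact: (pres_lift_gen phi_rels (inl x)).
by rewrite [LHS](pres_lift_gen phi_rels (inr (free_gen i))) /= free_lift_gen.
Qed.

End ReducedForm.
End MixedWords.

(** Mixed identities only need to be refuted on reduced words with at least one
    variable: a word without variables is a nontrivial constant, fixed by every
    substitution. *)
Lemma mixed_identity_free_reduced (G : groupType) :
  (forall n (g : G) (s : seq ('I_n * bool * G)), reduced s -> s != [::] ->
     exists sigma : 'I_n -> G, g * mixed_eval id sigma s != 1) ->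
  mixed_identity_free G.
Proof.
move=> eval_neq1 n w w1 id_w; have [g [s [rs w_eq]]] := reduced_form w.
have eval_w (f : UMagmaMorphism.type (free_product G (free_group 'I_n)) G) :
    (forall x, f (free_product_inl _ x) = x) ->
    f w = g * mixed_eval id (fun i => f (free_product_var G i)) s.
  move=> f_inl; rewrite w_eq gmulfM f_inl mixed_eval_morph; congr (_ * _).
  exact: eq_mixed_eval.
have [s0|s_neq0] := eqVneq s [::].
  have [f [f_inl _]] := free_product_lift (fun _ : 'I_n => 1 : G).
  apply: w1; move: (id_w f f_inl); rewrite (eval_w f f_inl) w_eq s0 /= !mulg1.
  by move=> ->; rewrite (@gmulf1 _ _ (@free_product_inl G (free_group 'I_n))).
have [sigma neq1] := eval_neq1 n g s rs s_neq0.
have [f [f_inl f_var]] := free_product_lift sigma.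
case/eqP: neq1; rewrite -(id_w f f_inl) (eval_w f f_inl); congr (_ * _).
exact: eq_mixed_eval.
Qed.

(** * Highly transitive actions with infinite supports *)

Section HighlyTransitiveMixedIdentityFree.
Variables (G : groupType) (T : choiceType) (act : G -> T -> T).
Hypothesis actG : is_group_action act.

Lemma actK g : cancel (act g) (act g^-1).
Proof. by move=> x; rewrite -actG.2 mulVg actG.1. Qed.

Lemma actKV g : cancel (act g^-1) (act g).
Proof. by move=> x; rewrite -actG.2 mulgV actG.1. Qed.

Definition partial_injection (M : seq (T * T)) : Prop :=
  {in M &, forall p q, (p.1 == q.1) = (p.2 == q.2)}.

(** Stated for lists with possible repetitions because the constraints read off
    a trajectory come as a list. *)
Lemma highly_transitive_extend M : highly_transitive_action act ->
  partial_injection M -> exists g, {in M, forall p, act g p.1 = p.2}.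
Proof.
move=> ht pM; pose t := in_tuple (undup M).
have tM j : tnth t j \in M by rewrite -mem_undup mem_tnth.
have tinj : injective (tnth t) by apply/tuple_uniqP; exact: undup_uniq.
have inj1 : injective (fun j => (tnth t j).1).
  move=> i j /eqP eq1; have := eq1; rewrite (pM _ _ (tM i) (tM j)) => /eqP eq2.
  by apply: tinj; apply/eqP; rewrite -pair_eqE /= /pair_eq eq1 eq2 eqxx.
have inj2 : injective (fun j => (tnth t j).2).
  move=> i j /eqP eq2; have := eq2; rewrite -(pM _ _ (tM i) (tM j)) => /eqP eq1.
  by apply: tinj; apply/eqP; rewrite -pair_eqE /= /pair_eq eq1 eq2 eqxx.
have [g gP] := (ht _).2 _ _ inj1 inj2.
exists g => p; rewrite -mem_undup => /(tnthP t) [j ->]; exact: gP.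
Qed.

Hypothesis fresh_moved : forall (g : G) (F : seq T),
  exists2 z, z \notin F & (g != 1 -> act g z != z).

Section Trajectory.
Variable n : nat.
Implicit Types (L : seq ('I_n * (T * T))) (s : seq ('I_n * bool * G)).

Definition constraints L i := [seq l.2 | l <- L & l.1 == i].

Lemma mem_constraints L i p : (p \in constraints L i) = ((i, p) \in L).
Proof.
apply/mapP/idP => [[[j q]]|iL]; last by exists (i, p); rewrite // mem_filter /= eqxx.
by rewrite mem_filter /= => /andP[/eqP -> jL] ->.
Qed.

Definition side (e : bool) (p : T * T) : T := if e then p.1 else p.2.

Definition edge (e : bool) (x y : T) : T * T := if e then (x, y) else (y, x).

(** The substitution is built along the trajectory of p, from the last letter
    of the word to the first. L records the values imposed on the variables: an
    item (i, (x, y)) asks that X_i send x to y. The element h is the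
    coefficient applied next, and z is taken fresh after h is known, so that h
    z meets no recorded point except possibly z itself, when h = 1. In that
    case the only conflict is a variable that undoes the previous step, which
    reducedness excludes. *)
Lemma trajectory s (h : G) : reduced s -> exists p L z, [/\
  forall sigma : 'I_n -> G,
    (forall i q, (i, q) \in L -> act (sigma i) q.1 = q.2) ->
    act (mixed_eval id sigma s) p = z,
  forall i, partial_injection (constraints L i),
  forall i e, ~~ ((h == 1) && cancels_head i e s) ->
    forall q, (i, q) \in L -> side e q != act h z
  & s != [::] -> act h z != p].
Proof.
elim: s h => [|[[i e] g] s IH] h.
  have [p _ _] := fresh_moved 1 [::].
  by exists p, [::], p; split=> // sigma _; rewrite /= actG.1.
move=> /= /andP[/(IH g) [p [L [z [Lz injL Lg sp]]]] nc].
pose z' := act g z.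
pose F := [:: p, z' & [seq l.2.1 | l <- L] ++ [seq l.2.2 | l <- L]].
have [q qF hq] := fresh_moved h (F ++ map (act h^-1) F).
move: qF; rewrite mem_cat negb_or => /andP[qF hqF].
have {}hqF : act h q \notin F.
  by apply: contra hqF => /(map_f (act h^-1)); rewrite actK.
have FL l : l \in L -> (l.2.1 \in F) && (l.2.2 \in F).
  by move=> lL; rewrite !inE !mem_cat !(map_f (fun l => _ l.2)) ?orbT.
have sideF l e' : l \in L -> side e' l.2 \in F.
  by move=> /FL /andP[]; case: e'.
have z'F : z' \in F by rewrite !inE eqxx orbT.
exists p, ((i, edge e z' q) :: L), q; split.
- move=> sigma sigmaL; rewrite !actG.2 Lz; last first.
    by move=> j r jL; apply: sigmaL; rewrite inE jL orbT.
  have := sigmaL i (edge e z' q); rewrite inE eqxx => /(_ isT).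
  by rewrite -/z'; case: e {nc sigmaL} => //= <-; rewrite actK.
- move=> j r r'; rewrite !mem_constraints !inE.
  have new r0 : (i, r0) \in L ->
      ((edge e z' q).1 == r0.1) = false /\ ((edge e z' q).2 == r0.2) = false.
    move=> r0L; have := Lg i e.
    have nc' : ~~ ((g == 1) && cancels_head i e s) by rewrite negb_and -implybE.
    move=> /(_ nc' _ r0L); rewrite -/z'.
    have [/= r1 r2] := andP (FL _ r0L).
    by case: (e) => /= zr; rewrite [z' == _]eq_sym (negbTE zr); split=> //;
      apply: contraNF qF => /eqP ->.
  move=> /orP[/eqP[ji ->]|rL] /orP[/eqP[ji' ->]|r'L].
  + by rewrite !eqxx.
  + by rewrite ji in r'L; have [-> ->] := new _ r'L.
  + by rewrite ji' in rL; have [n1 n2] := new _ rL; rewrite eq_sym n1 eq_sym n2.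
  + by apply: (injL j); rewrite mem_constraints.
- move=> j e' nc' r; rewrite inE => /orP[/eqP[ji ->]|rL].
    have [h1|h1] := eqVneq h 1; last first.
      have hqq := hq h1.
      have : side e' (edge e z' q) \in [:: z'; q].
        by case: (e); case: (e'); rewrite /= !inE eqxx ?orbT.
      rewrite !inE => /orP[] /eqP ->; last by rewrite eq_sym.
      by apply: contraNneq hqF => <-.
    move: nc'; rewrite h1 eqxx ji eqxx /= actG.1.
    have qz' : z' != q by apply: contraNneq qF => <-.
    by case: (e); case: (e') => //=.
  apply: contraNneq hqF => <-; exact: (sideF (j, r)).
- by move=> _; apply: contraNneq hqF => ->; rewrite !inE eqxx.
Qed.

End Trajectory.

(** A trajectory that ends away from its starting point witnesses that the word
    is nontrivial; high transitivity realizes each variable by a group element.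
    *)
Theorem highly_transitive_mixed_identity_free :
  highly_transitive_action act -> mixed_identity_free G.
Proof.
move=> ht; apply: mixed_identity_free_reduced => n g s rs s0.
have [p [L [z [Lz injL _ gzp]]]] := trajectory g rs.
have /choice[sigma sigmaP] : forall i : 'I_n, exists x : G,
    {in constraints L i, forall q, act x q.1 = q.2}.
  by move=> i; apply: highly_transitive_extend.
exists sigma; apply: contraTneq (gzp s0) => gs1; rewrite negbK.
rewrite -(Lz sigma) => [|i q iL]; last by apply: sigmaP; rewrite mem_constraints.
by rewrite -actG.2 gs1 actG.1.
Qed.

End HighlyTransitiveMixedIdentityFree.

(** * Distorted elements of acylindrical actions *)

Section SlimTriangles.
Local Open Scope ring_scope.
Variables (R : realType) (X : metricType R) (delta : R).
Hypotheses (geoX : geodesic_space X) (delta_ge0 : 0 <= delta).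
Hypothesis slimX : slim_triangles X delta.
Local Notation d := (@mdist R X).
Implicit Types (x y z w p q : X) (S : set X).

Let tri y x z : d x z <= d x y + d y z. Proof. exact: metric_triangle. Qed.
Let dxx x : d x x = 0. Proof. exact: mdistxx. Qed.

Lemma geodesic_segment_ends x y S : geodesic_segment x y S -> S x /\ S y.
Proof.
move=> [c [c0 c1 _ ->]]; split.
  by exists 0; rewrite //= in_itv /= lexx mdist_ge0.
by exists (d x y); rewrite //= in_itv /= lexx mdist_ge0.
Qed.

Lemma geodesic_segment_dist x y S p : geodesic_segment x y S -> S p ->
  d x p + d p y = d x y.
Proof.
move=> [c [c0 c1 ciso ->]] [t /= tI <-].
have L0 : 0 \in `[0, d x y] by rewrite in_itv /= lexx mdist_ge0.
have L1 : d x y \in `[0, d x y] by rewrite in_itv /= lexx mdist_ge0.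
rewrite -[X in d X (c t)]c0 -[X in d (c t) X]c1 !ciso //.
by move: tI; rewrite in_itv /= => /andP[t0 t1]; rewrite ler0_norm ?ler0_norm; lra.
Qed.

Definition near_set (eps : R) S p : Prop := exists2 q, S q & d p q <= eps.

Lemma near_segment_dist eps x y S p : geodesic_segment x y S ->
  near_set eps S p -> d x p + d p y <= d x y + 2 * eps.
Proof.
move=> Sxy [q Sq pq]; have := geodesic_segment_dist Sxy Sq.
have := tri q x p; have := tri q p y; rewrite (metric_sym q p); lra.
Qed.

Lemma geodesic_segment_dist_between x y S p q : geodesic_segment x y S -> S p -> S q ->
  d p q = `|d x p - d x q|.
Proof.
move=> [c [c0 c1 ciso ->]] [t /= tI <-] [u /= uI <-].
have L0 : 0 \in `[0, d x y] by rewrite in_itv /= lexx mdist_ge0.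
rewrite -c0 !ciso //.
move: tI uI; rewrite !in_itv /= => /andP[t0 _] /andP[u0 _].
by rewrite !sub0r !normrN (ger0_norm t0) (ger0_norm u0).
Qed.

(** Each point of the segment is close to one of the other two sides of the
    triangle. Sampling it at unit steps, take the first sample close to the
    side from y to z: the previous sample is close to the other side, so the
    first one is too at the cost of one more unit. *)
Lemma segment_switch x z Sxz y : geodesic_segment x z Sxz ->
  exists2 p, Sxz p & d x p + d p y <= d x y + 2 * (delta + 1) /\
  d y p + d p z <= d y z + 2 * (delta + 1).
Proof.
move=> gxz; have [Sxy gxy] := geoX x y.
have [Syz gyz] := geoX y z; have [Szy gzy] := geoX z y.
have [c [c0 c1 ciso Sc]] := gxz; set L := d x z in c1 ciso Sc.
have L0 : 0 <= L by exact: mdist_ge0.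
pose t (k : nat) := Num.min (k%:R : R) L.
have tI k : t k \in `[0, L].
  by rewrite in_itv /= le_min ler0n L0 ge_min lexx orbT.
have Sct k : Sxz (c (t k)) by rewrite Sc; exists (t k) => //; exact: tI.
pose A k := `[< near_set delta Szy (c (t k)) >].
have switch k : A k \/ near_set delta Sxy (c (t k)).
  have [q [qS|qS] pq] := slimX gxz gzy gxy (Sct k).
    by left; apply/asboolP; exists q.
  by right; exists q.
have exA : exists k, A k.
  have [k _ Lk] : exists2 k, True & L <= k%:R.
    by exists (Num.bound L) => //; apply/ltW/archi_boundP.
  exists k; apply/asboolP; exists z; first exact: (geodesic_segment_ends gzy).1.
  by rewrite /t min_r // c1 dxx.
case: (ex_minnP exA) => k Ak kmin; exists (c (t k)).
  exact: Sct.
split; last first.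
  have /asboolP := Ak => /(near_segment_dist gzy).
  by rewrite (metric_sym z y) (metric_sym _ y) (metric_sym z); lra.
case: k Ak kmin => [|k] Ak kmin.
  rewrite /t min_l // c0 dxx; have := delta_ge0; lra.
have [/kmin|Bk] := switch k; first by rewrite ltnn.
have := near_segment_dist gxy Bk.
have : d (c (t k)) (c (t k.+1)) <= 1.
  rewrite ciso //; rewrite /t -addn1 natrD.
  by case: (leP (k%:R : R) L); case: (leP (k%:R + 1 : R) L) => *;
    rewrite ler_norml; apply/andP; split; lra.
have := tri (c (t k)) x (c (t k.+1)); have := tri (c (t k)) (c (t k.+1)) y.
rewrite (metric_sym (c (t k.+1)) (c (t k))); lra.
Qed.

(** Take the points p and q where the segment from x to z leaves the
    neighbourhoods of the sides through y and through w. Both detours nearly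
    realize the distances to x and z, and the order of p and q on the segment
    decides which of the two sums is large enough. *)
Lemma four_point x y z w :
  d x z + d y w <= d x y + d z w + (4 * delta + 4) \/
  d x z + d y w <= d x w + d y z + (4 * delta + 4).
Proof.
have [Sxz gxz] := geoX x z.
have [p Sp [xpy ypz]] := segment_switch y gxz.
have [q Sq [xqw wqz]] := segment_switch w gxz.
have := geodesic_segment_dist gxz Sp; have := geodesic_segment_dist gxz Sq.
have := tri p y w; have := tri q p w.
rewrite (geodesic_segment_dist_between gxz Sp Sq).
rewrite (metric_sym y p) in ypz *; rewrite (metric_sym w q) (metric_sym w z) in wqz.
by case: (lerP (d x p) (d x q)) => _; [right|left]; lra.
Qed.

End SlimTriangles.

Section DistortedElement.
Local Open Scope ring_scope.
Variables (R : realType) (X : metricType R) (delta : R).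
Hypotheses (geoX : geodesic_space X) (delta_ge0 : 0 <= delta).
Hypothesis slimX : slim_triangles X delta.
Variables (G : groupType) (act : G -> X -> X).
Hypothesis isoG : isometric_action act.
Variables (a b : G).
Hypothesis a_distorted : (b^-1 * a * b = a ^+ 2)%g.
Variable x : X.
Local Notation d := (@mdist R X).
Local Notation C := (4 * delta + 4).

Let tri y z w : d z w <= d z y + d y w. Proof. exact: metric_triangle. Qed.

Let act1 z : act 1%g z = z. Proof. exact: isoG.1.1. Qed.
Let actM g h z : act (g * h)%g z = act g (act h z). Proof. exact: isoG.1.2. Qed.
Let act_iso g y z : d (act g y) (act g z) = d y z. Proof. exact: isoG.2. Qed.

Definition orbit_point (n : nat) : X := act (a ^+ n)%g x.
Local Notation P := orbit_point.

Definition orbit_length (n : nat) : R := d x (P n).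
Local Notation f := orbit_length.

Lemma orbit_pointD i n : P (i + n) = act (a ^+ i)%g (P n).
Proof. by rewrite /P expgnDr actM. Qed.

Lemma orbit_dist i n : d (P i) (P (i + n)) = f n.
Proof. by rewrite orbit_pointD act_iso. Qed.

Lemma orbit_length_ge0 n : 0 <= f n. Proof. exact: mdist_ge0. Qed.

(** a^(2n) is conjugate to a^n by b, so it displaces x at most as much as a^n
    displaces b x. *)
Lemma orbit_length_double n : f (n + n) <= f n + 2 * d x (act b x).
Proof.
have -> : f (n + n) = d (act b x) (act (a ^+ n)%g (act b x)).
  rewrite -[RHS](act_iso b^-1%g) -actM mulVg act1 -!actM -mulgA -conjgE conjXg.
  by rewrite conjgE mulgA a_distorted -expgnA mul2n -addnn.
have := tri x (act b x) (act (a ^+ n)%g (act b x)).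
have := tri (P n) x (act (a ^+ n)%g (act b x)).
rewrite act_iso (metric_sym (act b x) x) /f; lra.
Qed.

(** The four-point inequality applied to the orbit points of indices 0, j, n, n
    + j makes f(n - j) + f(n + j) close to 2 f(n). Applied to 0, n, n + j, 2n,
    together with the bound on f(2n), it makes f(n - j) close to f(n + j). The
    power a^j thus acts near the middle of a long orbit segment like a
    parabolic element preserving its horospheres. *)
Lemma orbit_length_stable n j : (j <= n)%N ->
  2 * f j + 2 * d x (act b x) + 2 * C < f n -> `|f (n - j)%N - f n| <= C.
Proof.
move=> le_jn; have [m ->] : exists m, n = (j + m)%N by exists (n - j)%N; lia.
rewrite addKn => big; have fp := four_point geoX delta_ge0 slimX.
have B0 : 0 <= d x (act b x) by exact: mdist_ge0.
have fj0 := orbit_length_ge0 j; have := delta_ge0 => delta0.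
have PE0 k : d x (P k) = f k by [].
have Pj : d (P j) (P (j + m)%N) = f m by exact: orbit_dist.
have Pjn : d (P j) (P (j + m + j)%N) = f (j + m)%N.
  by rewrite addnAC -addnA orbit_dist addnC.
have Pn : d (P (j + m)%N) (P (j + m + j)%N) = f j by exact: orbit_dist.
have Pn2 : d (P (j + m)%N) (P (j + m + (j + m))%N) = f (j + m)%N.
  exact: orbit_dist.
have Pnj2 : d (P (j + m + j)%N) (P (j + m + (j + m))%N) = f m.
  by rewrite -[(j + m + (j + m))%N]/(j + m + (j + m))%N addnA orbit_dist.
have f2 := orbit_length_double (j + m).
have t1 := tri (P (j + m + j)%N) x (P (j + m)%N).
have t2 := tri (P j) x (P (j + m)%N).
have i1 := fp x (P j) (P (j + m)%N) (P (j + m + j)%N).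
have i2 := fp x (P j) (P (j + m + j)%N) (P (j + m)%N).
have i3 := fp x (P (j + m)%N) (P (j + m + j)%N) (P (j + m + (j + m))%N).
have i4 := fp x (P (j + m + j)%N) (P (j + m)%N) (P (j + m + (j + m))%N).
rewrite ?[d (P (j + m + j)%N) (P (j + m)%N)]metric_sym in t1 i1 i2 i3 i4.
rewrite ?PE0 ?Pj ?Pjn ?Pn ?Pn2 ?Pnj2 in t1 t2 i1 i2 i3 i4.
rewrite ler_norml; apply/andP; split.
  by case: i1 i2 i3 i4 => [] ? [] ? [] ? [] ?; lra.
by case: i1 i2 i3 i4 => [] ? [] ? [] ? [] ?; lra.
Qed.

(** Deep inside, the geodesic from x to a^n x fellow-travels its translate by
    a^j: the two short sides of the quadrilateral are out of reach. The shift
    along the geodesic is f(n - j) - f(n), which is bounded, so c s is close to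
    its own image. *)
Lemma displacement_bounded n j (c : R -> X) (s : R) : (j <= n)%N ->
  2 * f j + 2 * d x (act b x) + 2 * C < f n ->
  c 0 = x -> c (f n) = P n ->
  {in `[0, f n] &, forall s t, d (c s) (c t) = `|s - t|} ->
  f j + delta < s -> s < f n - f j - 2 * delta ->
  d (c s) (act (a ^+ j)%g (c s)) <= 4 * delta + C.
Proof.
move=> le_jn big c0 c1 ciso s_lo s_hi; set y := c s.
have fj0 := orbit_length_ge0 j; have := delta_ge0 => delta0.
have stable := orbit_length_stable le_jn big.
set u := (a ^+ j)%g; pose S := c @` `[0, f n].
have gS : geodesic_segment x (P n) S by exists c.
have guS : geodesic_segment (P j) (P (j + n)) (act u @` S).
  exists (act u \o c); split=> /=; first by rewrite c0.
  - by rewrite orbit_dist c1 orbit_pointD.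
  - by move=> s1 s2; rewrite orbit_dist act_iso; exact: ciso.
  - by rewrite orbit_dist /S -image_comp.
have sI : s \in `[0, f n] by rewrite in_itv /=; apply/andP; split; lra.
have Sy : S y by exists s.
have [S1 g1] := geoX (P n) (P j); have [S2 g2] := geoX x (P j).
have [S3 g3] := geoX (P n) (P (j + n)).
have dxy : d x y = s.
  rewrite -c0 ciso // ?in_itv /= ?lexx ?orbit_length_ge0 //.
  by rewrite sub0r normrN ger0_norm; lra.
have dyP := geodesic_segment_dist gS Sy.
rewrite dxy -[d x (P n)]/(f n) in dyP.
have dPnj : d (P n) (P j) = f (n - j)%N.
  by rewrite metric_sym -(subnKC le_jn) orbit_dist addKn.
have [q [S1q|S2q] yq] := slimX gS g1 g2 Sy; last first.
  have := geodesic_segment_dist g2 S2q; have := tri q x y.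
  rewrite (metric_sym q y) dxy -[d x (P j)]/(f j).
  by have : 0 <= d q (P j) := mdist_ge0 _ _; lra.
have q1 := geodesic_segment_dist g1 S1q; rewrite dPnj in q1.
have q2 := tri q y (P n); have q3 := tri y q (P n).
rewrite (metric_sym q (P n)) (metric_sym q y) in q1 q2 q3.
have [p [S4p|S3p] qp] := slimX g1 guS g3 S1q; last first.
  have p1 := geodesic_segment_dist g3 S3p; have p2 := tri p (P n) q.
  rewrite [in d (P n) (P (j + n)%N)]addnC orbit_dist (metric_sym p q) in p1 p2.
  by have : 0 <= d p (P (j + n)%N) := mdist_ge0 _ _; lra.
have uy : (act u @` S) (act u y) by exists y.
have puy := geodesic_segment_dist_between guS S4p uy.
have Pjuy : d (P j) (act u y) = s by rewrite /P act_iso.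
rewrite Pjuy in puy.
have p1 := tri q (P j) p; have p2 := tri p (P j) q.
rewrite (metric_sym (P j) q) (metric_sym p q) in p1 p2.
have t1 := tri q y p; have t2 := tri p y (act u y).
have : `|d (P j) p - s| <= 2 * delta + C.
  move: stable; rewrite !ler_norml => /andP[st1 st2]; apply/andP; split; lra.
lra.
Qed.

End DistortedElement.

Lemma card_gt_injection (T : choiceType) (S : set T) (u : nat -> T) N :
  injective u -> (forall k, (k <= N)%N -> S (u k)) -> ~ (S #<= `I_N)%card.
Proof.
move=> u_inj uS SN.
have : (`I_N.+1 #<= `I_N)%card.
  apply: card_le_trans SN; apply: card_le_trans (subset_card_le (A := u @` `I_N.+1) _).
    by rewrite (card_le_eqr (inj_card_eq (in2W u_inj))).
  by move=> _ [k /= kN <-]; exact: uS.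
by rewrite card_le_II ltnn.
Qed.

(** If the orbit of x under the powers of a is bounded, commensuration
    transports the bound to g x for infinitely many powers, whatever g is. If
    it is unbounded, two points at distance r inside a long orbit segment are
    moved little by the first N powers. Either way more elements move two
    distant points a little than acylindricity permits. *)
Theorem distorted_commensurated_not_acylindrically_hyperbolic
    (R : realType) (G : groupType) (a b : G) :
  injective (fun n : nat => a ^+ n) -> b^-1 * a * b = a ^+ 2 ->
  (forall g, exists p q, [/\ (0 < p)%N, (0 < q)%N & a ^+ p * g = g * a ^+ q]) ->
  ~ acylindrically_hyperbolic R G.
Proof.
move=> a_inj a_dist a_comm [_ [X [act [[geoX [delta delta0 slimX]]]]]].
move=> [isoG acyl] [[x _] /(_ x) unb].
have [[act1 actM] act_iso] := isoG.
pose f := orbit_length act a x; pose d := @mdist R X.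
have f_power g p q k : a ^+ p * g = g * a ^+ q ->
    d (act g x) (act (a ^+ (p * k)) (act g x)) = f (q * k)%N.
  move=> comm; rewrite -actM; have -> : a ^+ (p * k) * g = g * a ^+ (q * k).
    rewrite !expgnA; elim: k => [|k IH]; first by rewrite mulg1 mul1g.
    by rewrite !expgSr -mulgA comm !mulgA IH.
  by rewrite actM /d act_iso.
have [[M fM]|f_unb] := pselect (exists M : R, forall n, (f n <= M)%R).
  pose eps : R := (`|M| + 1)%R.
  have eps0 : (0 < eps)%R by rewrite ltr_wpDl.
  have f_eps n : (f n <= eps)%R.
    by rewrite (le_trans (fM n)) // (le_trans (ler_norm M)) // lerDl.
  have [r [N [r0 N0 few]]] := acyl eps eps0.
  have [g gr] : exists g, (r <= d x (act g x))%R.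
    apply: contrapT => small; apply: unb; exists r => _ _ [g _ <-] [h _ <-].
    rewrite leNgt; apply/negP => /ltW big; apply: small; exists (g^-1 * h).
    by rewrite /d actM -(act_iso g) -(actM g g^-1) mulgV act1.
  have [p [q [p0 q0 comm]]] := a_comm g.
  apply: (card_gt_injection (u := fun k => a ^+ (p * k)) _ _ (few _ _ gr)).
    by move=> k l /a_inj /eqP; rewrite eqn_pmul2l // => /eqP.
  move=> k _ /=; split; last by rewrite -/d (f_power g p q).
  exact: f_eps.
have f_big K : exists n, (K < f n)%R.
  apply: contrapT => small; apply: f_unb; exists K => n.
  by rewrite leNgt; apply/negP => big; apply: small; exists n.
pose C : R := (4 * delta + 4)%R; pose eps : R := (4 * delta + C)%R.
have eps0 : (0 < eps)%R by rewrite /eps /C; lra.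
have [r [N [r0 N0 few]]] := acyl eps eps0.
have [F fF] : exists F : R, forall j, (j <= N)%N -> (f j <= F)%R.
  exists (\sum_(j < N.+1) f j)%R => j jN.
  rewrite (bigD1 (Ordinal (jN : j < N.+1)%N)) //= lerDl.
  by apply: sumr_ge0 => i _; exact: mdist_ge0.
have F0 : (0 <= F)%R by rewrite (le_trans _ (fF 0 isT)) // mdist_ge0.
have B0 : (0 <= d x (act b x))%R by exact: mdist_ge0.
have [n fn] := f_big (3 * F + 2 * d x (act b x) + 2 * C + 3 * delta + r + 4)%R.
have Nn : (N <= n)%N.
  by rewrite leqNgt; apply/negP => /ltnW /fF; rewrite /C in fn *; lra.
have [S [c [c0 c1 ciso _]]] := geoX x (act (a ^+ n) x).
pose s : R := (F + delta + 1)%R.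
have far : (r <= mdist (c s) (c (s + r)%R))%R.
  rewrite ciso; first by rewrite distrC addrAC subrr add0r ler_norm.
    by rewrite in_itv /= /s -[mdist _ _]/(f n) /C in fn *; apply/andP; split; lra.
  by rewrite in_itv /= /s -[mdist _ _]/(f n) /C in fn *; apply/andP; split; lra.
apply: (card_gt_injection a_inj _ (few _ _ far)) => j jN.
have fj := fF j jN; have fj0 : (0 <= f j)%R by exact: mdist_ge0.
have disp t : (s <= t)%R -> (t <= s + r)%R ->
    (mdist (c t) (act (a ^+ j)%g (c t)) <= eps)%R.
  move=> s_t t_s; apply: (displacement_bounded geoX delta0 slimX isoG a_dist
    (leq_trans jN Nn) _ c0 c1 ciso).
  - by rewrite -/f -/d /C in fn *; lra.
  - by rewrite -/f -/d; rewrite /s in s_t; lra.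
  - by rewrite -/f -/d; rewrite /s /C in s_t t_s fn; lra.
by split; apply: disp; rewrite ?lexx ?lerDl ?(ltW r0).
Qed.

(** * Groups of bijections and actions of presented groups *)

Section Bijections.
Variable T : Type.

Definition bijection :=
  {p : (T -> T) * (T -> T) | cancel p.1 p.2 /\ cancel p.2 p.1}.

HB.instance Definition _ := gen_eqMixin bijection.
HB.instance Definition _ := gen_choiceMixin bijection.

Definition bij_fun (s : bijection) : T -> T := (sval s).1.

Lemma bijectionP (r s : bijection) : bij_fun r =1 bij_fun s -> r = s.
Proof.
case: r s => [[f f'] [/= fK f'K]] [[g g'] [/= gK g'K]]; rewrite /bij_fun /= => fg.
apply: eq_exist; congr (_, _); apply/funext => x; first exact: fg.
by apply: (can_inj gK); rewrite g'K -fg f'K.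
Qed.

Definition bij_of (f g : T -> T) (fK : cancel f g) (gK : cancel g f) :
  bijection := exist _ (f, g) (conj fK gK).

Definition bij_one : bijection := @bij_of id id (fun=> erefl) (fun=> erefl).

Definition bij_mul (r s : bijection) : bijection :=
  bij_of (can_comp (svalP r).1 (svalP s).1) (can_comp (svalP s).2 (svalP r).2).

Definition bij_inv (s : bijection) : bijection :=
  bij_of (svalP s).2 (svalP s).1.

Fact bij_mulA : associative bij_mul.
Proof. by move=> r s t; apply: bijectionP. Qed.
Fact bij_mul1g : left_id bij_one bij_mul.
Proof. by move=> r; apply: bijectionP. Qed.
Fact bij_mulg1 : right_id bij_one bij_mul.
Proof. by move=> r; apply: bijectionP. Qed.
Fact bij_mulVg : left_inverse bij_one bij_inv bij_mul.
Proof. by move=> r; apply: bijectionP => x; exact: (svalP r).1. Qed.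
Fact bij_mulgV : right_inverse bij_one bij_inv bij_mul.
Proof. by move=> r; apply: bijectionP => x; exact: (svalP r).2. Qed.

HB.instance Definition _ := isGroup.Build bijection
  bij_mulA bij_mul1g bij_mulg1 bij_mulVg bij_mulgV.

End Bijections.

(** * The group < a, b, t | b^-1 a b = a^2, [a, t] = 1 > *)

Section AbtGroup.

Definition abt_A : abt_group := pres_class abt_rels abt_a.
Definition abt_B : abt_group := pres_class abt_rels abt_b.
Definition abt_T : abt_group := pres_class abt_rels abt_t.

Local Notation a := abt_A.
Local Notation b := abt_B.
Local Notation t := abt_T.

Lemma abt_relation : b^-1 * a * b = a ^+ 2.
Proof.
have := @pres_class_rel _ abt_rels _ (or_introl erefl).
by rewrite expg2 !pres_classM !pres_classV !pres_classM => /divg1_eq.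
Qed.

Lemma abt_commute : a * t = t * a.
Proof.
have := @pres_class_rel _ abt_rels _ (or_intror erefl).
by rewrite /commg /conjg !pres_classM !pres_classV => /eqP/commgP.
Qed.

Lemma abt_ind (S : set abt_group) : is_subgroup S -> S a -> S b -> S t ->
  forall g, S g.
Proof.
move=> sS Sa Sb St; apply: (presented_group_ind sS).
by move=> [[|[|[|//]]] i]; rewrite (bool_irrelevance i isT).
Qed.

Lemma abt_action (T : Type) (fa fb ft : bijection T) :
  (forall x, bij_fun fa (bij_fun fb x) = bij_fun fb (bij_fun fa (bij_fun fa x))) ->
  (forall x, bij_fun fa (bij_fun ft x) = bij_fun ft (bij_fun fa x)) ->
  exists act : abt_group -> T -> T, is_group_action act /\
    [/\ act a = bij_fun fa, act b = bij_fun fb & act t = bij_fun ft].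
Proof.
move=> rel_ab rel_at.
pose phi (i : 'I_3) := if val i is i'.+1 then (if i' is 0 then fb else ft) else fa.
have phi_rels r : abt_rels r -> free_lift phi r = 1.
  case=> ->.
    rewrite expg2 gmulfF !gmulfM gmulfV /= !free_lift_gen /=.
    apply/eqP; rewrite divg_eq1 -mulgA; apply/eqP.
    apply: (mulgI fb); rewrite mulVKg; exact: bijectionP.
  rewrite gmulfR /= !free_lift_gen /=; apply/eqP/commgP; exact: bijectionP.
pose rho := pres_lift_of phi_rels.
have rhoE i : rho (pres_gen _ i) = phi i by exact: pres_lift_gen.
exists (fun g => bij_fun (rho g)); split; last first.
  by split; congr bij_fun; rewrite -[LHS]/(rho (pres_gen _ _)) rhoE.
have rho1 : rho 1 = 1 by exact: (@gmulf1 _ _ rho).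
have rhoM g h : rho (g * h) = rho g * rho h by exact: (@gmulfM _ _ rho).
by split=> [x|g h x]; rewrite ?rho1 ?rhoM.
Qed.

(** Comes from the action on Z in which b is the unit translation and a, t act
    trivially. *)
Lemma abt_height : exists h : abt_group -> int,
  [/\ {morph h : x y / x * y >-> (x + y)%R}, h a = 0%R, h b = 1%R & h t = 0%R].
Proof.
pose fb := bij_of (addrK (1 : int)%R) (subrK (1 : int)%R).
have [|//|act [[act1 actM] [acta actb actt]]] := @abt_action int 1 fb 1.
  by [].
have act_add g n : act g n = (act g 0 + n)%R.
  have : [set g | forall n, act g n = (act g 0 + n)%R] g; last exact.
  apply: abt_ind => [||m|]; rewrite /= ?acta ?actb ?actt //.
  - split=> [n0|x y Sx Sy n0]; first by rewrite !act1 add0r.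
    have Vy n1 : act y^-1 n1 = (n1 - act y 0)%R.
      have e := Sy (act y^-1 n1); rewrite -actM mulgV act1 in e.
      by rewrite [in RHS]e addrC addKr.
    by rewrite !actM !Vy Sx [in RHS]Sx sub0r addrA addrAC.
  - by move=> m; rewrite add0r.
  - by rewrite /bij_fun /= add0r addrC.
  - by move=> m; rewrite add0r.
exists (fun g => act g 0%R); split; rewrite ?acta ?actb ?actt //.
by move=> x y; rewrite actM act_add.
Qed.

(** The affine action of the Baumslag-Solitar quotient, in which t is killed:
    it detects the powers of a, and shows how b rescales them. *)
Lemma abt_affine : exists rho : abt_group -> rat -> rat,
  is_group_action rho /\
  [/\ forall z, rho a z = (z + 1)%R, forall z, rho b z = (z / 2)%R &
      forall z, rho t z = z].
Proof.
have u2 : (2 : rat)%R \is a GRing.unit by [].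
pose fa := bij_of (addrK (1 : rat)%R) (subrK (1 : rat)%R).
pose fb := bij_of (divrK u2) (mulrK u2).
have [z|//|act [actG [acta actb actt]]] := @abt_action rat fa fb 1.
  by rewrite /bij_fun /=; field.
by exists act; split=> //; rewrite acta actb actt.
Qed.

End AbtGroup.

(** * A highly transitive action of the group < a, b, t > *)

(** Used to recognize a window from the height of a single point in it. *)
Lemma disjoint_tiling (K : nat -> nat) m m' (z : int) :
  ((\sum_(j < m) K j)%N%:Z <= z < (\sum_(j < m.+1) K j)%N%:Z)%R ->
  ((\sum_(j < m') K j)%N%:Z <= z < (\sum_(j < m'.+1) K j)%N%:Z)%R -> m = m'.
Proof.
have mono i j : (i <= j)%N -> (\sum_(l < i) K l <= \sum_(l < j) K l)%N.
  by move=> /subnKC <-; rewrite big_split_ord /= leq_addr.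
move=> /andP[z1 z2] /andP[z3 z4].
have [lt_mm'|lt_m'm|//] := ltngtP m m'.
  by have := mono _ _ lt_mm'; lia.
by have := mono _ _ lt_m'm; lia.
Qed.

Section PartialSwap.
Variables (T : Type) (rel : T -> T -> Prop).
Hypothesis rel_fun : forall p q q', rel p q -> rel p q' -> q = q'.
Hypothesis rel_inj : forall p p' q, rel p q -> rel p' q -> p = p'.
Hypothesis rel_disjoint : forall p q r, rel p q -> rel q r -> False.

(** Exchanging the two sides of a partial injection, and fixing everything
    else, extends it to an involution. *)
Lemma partial_swap : exists s : T -> T, [/\ involutive s,
  forall p q, rel p q -> s p = q, forall p q, rel p q -> s q = p &
  forall p, (forall q, ~ rel p q) -> (forall q, ~ rel q p) -> s p = p].
Proof.
have /choice[s sP] : forall p, exists q, rel p q \/ rel q p \/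
    [/\ q = p, forall r, ~ rel p r & forall r, ~ rel r p].
  move=> p; have [[q pq]|np] := pselect (exists q, rel p q); first by exists q; left.
  have [[q qp]|nq] := pselect (exists q, rel q p); first by exists q; right; left.
  by exists p; right; right; split=> // r pr; [apply: np | apply: nq]; exists r.
have s_dom p q : rel p q -> s p = q.
  move=> pq; case: (sP p) => [/rel_fun|[/rel_disjoint|[_ /(_ q)//]]].
    exact.
  by move=> /(_ q pq).
have s_cod p q : rel p q -> s q = p.
  move=> pq; case: (sP q) => [qr|[/rel_inj|[_ _ /(_ p)//]]].
    by case: (rel_disjoint pq qr).
  exact.
exists s; split=> // [p|p np nq].
  case: (sP p) => [/s_cod//|[/s_dom//|[sp _ _]]]; by rewrite !sp.
by case: (sP p) => [/np//|[/nq//|[]]].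
Qed.

End PartialSwap.

Section HighTransitivity.
Local Notation G := abt_group.
Local Notation a := abt_A.
Local Notation b := abt_B.
Local Notation t := abt_T.

Lemma abt_A_inj : injective (fun n : nat => a ^+ n).
Proof.
have [rho [[rho1 rhoM] [rho_a _ _]]] := abt_affine.
have rhoX n : rho (a ^+ n) 0%R = n%:R%R.
  elim: n => [|n IH]; first exact: rho1.
  by rewrite expgS rhoM IH rho_a -natr1.
move=> m n eq_mn; apply/eqP; rewrite -(eqr_nat rat) -!rhoX.
by rewrite [a ^+ m]eq_mn.
Qed.

(** Quotients of natural powers describe the cyclic group generated by a
    without integer exponents. *)
Definition power_of_a (u : G) : Prop := exists k l, u = a ^+ k / a ^+ l.

Lemma power_of_aF u v : power_of_a u -> power_of_a v -> power_of_a (u / v).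
Proof.
move=> [k [l ->]] [k' [l' ->]]; exists (k + l')%N, (l + k')%N.
have aC i j : commute (a ^+ i) (a ^+ j) by apply: commuteX2.
have c : commute (a ^+ l)^-1 (a ^+ l' / a ^+ k').
  by apply: commuteM; [|apply: commuteV]; apply: commute_sym; apply: commuteV.
by rewrite invgF -mulgA c !expgnDr invgM !mulgA.
Qed.

Lemma power_of_a1 : power_of_a 1.
Proof. by exists 0%N, 0%N; rewrite mulgV. Qed.

Lemma power_of_aX k : power_of_a (a ^+ k).
Proof. by exists k, 0%N; rewrite expg0 divg1. Qed.

Lemma power_of_a_t u : power_of_a u -> commute u t.
Proof.
have at_ n : commute t (a ^+ n).
  by apply: commuteX; exact: (esym abt_commute).
by move=> [k [l ->]]; apply: commute_sym; apply: commuteM => //; exact: commuteV.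
Qed.

(** If b^n x and b^n y are in the same orbit of the powers of a, then x y^-1
    acts on the rationals as the translation by an integer multiple of 2^n. For
    large n this integer has to vanish. *)
Lemma b_power_separates (x y : G) : exists n0, forall n u, (n0 <= n)%N ->
  power_of_a u -> b ^+ n * x = u * (b ^+ n * y) -> x = y.
Proof.
have [rho [[rho1 rhoM] [rho_a rho_b _]]] := abt_affine.
have rho_aX n z : rho (a ^+ n) z = (z + n%:R)%R.
  elim: n z => [|n IH] z; first by rewrite rho1 addr0.
  by rewrite expgS rhoM IH rho_a -natr1 addrA.
have rho_bX n z : rho (b ^+ n) z = (z / 2 ^+ n)%R.
  elim: n z => [|n IH] z; first by rewrite rho1 expr0 divr1.
  by rewrite expgS rhoM IH rho_b exprSr invfM mulrA.
pose z0 := rho y^-1 0%R; pose w := rho x z0.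
exists (Num.bound `|w|%R) => n u w_n [k [l ->]] eq_xy.
have := congr1 (fun g => rho g z0) eq_xy.
rewrite /= !rhoM -/w -[rho y z0]rhoM mulgV rho1 !rho_bX mul0r.
have -> : rho (a ^+ l)^-1 0%R = (- l%:R)%R.
  have := rho_aX l (rho (a ^+ l)^-1 0%R); rewrite -rhoM mulgV rho1 => /eqP.
  by rewrite eq_sym addr_eq0 => /eqP.
rewrite rho_aX => w_eq.
have two_n : (0 < 2 ^+ n :> rat)%R by rewrite exprn_gt0.
have kl : k = l.
  have wE : w = ((k%:Z - l%:Z)%:~R * 2 ^+ n)%R.
    rewrite -[LHS](divfK (lt0r_neq0 two_n)) w_eq rmorphB /= addrC.
    by rewrite -!pmulrn.
  have w_small : (`|w| < 2 ^+ n)%R.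
    have w_bound : (`|w| < (Num.bound `|w|)%:R)%R by apply: archi_boundP.
    apply: lt_le_trans w_bound _; rewrite -natrX ler_nat.
    by rewrite (leq_trans w_n) // ltnW // ltn_expl.
  move: w_small; rewrite wE normrM (ger0_norm (ltW two_n)).
  rewrite -[ltRHS]mul1r ltr_pM2r // -intr_norm ltrz1; lia.
by move: eq_xy; rewrite kl mulgV mul1g => /mulgI.
Qed.

Definition eval_abt_word (w : seq ('I_3 * bool)) : G :=
  pres_class abt_rels (free_class w).

Lemma eval_abt_word_surj g : exists w, eval_abt_word w = g.
Proof.
have [p ->] := pres_class_surj g.
by exists (repr p); rewrite /eval_abt_word free_classK.
Qed.

(** A task prescribes finitely many values of a permutation of G. Pairs of
    words in the generators make the tasks countable; integers that encode no
    list give the empty task. *)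
Definition task (c : nat) : seq (G * G) :=
  if unpickle c is Some s then
    [seq (eval_abt_word p.1, eval_abt_word p.2)
       | p <- s : seq (seq ('I_3 * bool) * seq ('I_3 * bool))]
  else [::].

Lemma task_surj (M : seq (G * G)) : exists c, task c = M.
Proof.
suff [s <-] : exists s, [seq (eval_abt_word p.1, eval_abt_word p.2) | p <- s] = M.
  by exists (pickle s); rewrite /task pickleK.
elim: M => [|[x y] M [s <-]]; first by exists [::].
have [v <-] := eval_abt_word_surj x; have [w <-] := eval_abt_word_surj y.
by exists ((v, w) :: s).
Qed.

Lemma b_power_separates_seq (F : seq G) : exists n0, forall n u, (n0 <= n)%N ->
  power_of_a u -> {in F &, forall x y, b ^+ n * x = u * (b ^+ n * y) -> x = y}.
Proof.
have /choice[n0 n0P] : forall p : G * G, exists n0, forall n u, (n0 <= n)%N ->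
    power_of_a u -> b ^+ n * p.1 = u * (b ^+ n * p.2) -> p.1 = p.2.
  by move=> [x y]; exact: b_power_separates.
exists (\max_(p <- [seq (x, y) | x <- F, y <- F]) n0 p) => n u le_n pu x y xF yF.
apply: (n0P (x, y)) pu => //; apply: leq_trans le_n.
by apply: (@leq_bigmax_seq _ _ _ n0) => //; apply: allpairs_f.
Qed.

(** Task c uses the windows numbered 2c and 2c + 1: its sources are translated
    by a power of b to heights in the first one, its targets to heights in the
    second one. *)
Theorem abt_highly_transitive_action : exists act : G -> G -> G,
  [/\ is_group_action act, highly_transitive_action act &
      forall g (F : seq G), exists2 z, z \notin F & (g != 1 -> act g z != z)].
Proof.
have [h [hM ha hb ht]] := abt_height.
have h1 : h 1 = 0%R by have := hM 1 1; rewrite mulg1; lia.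
have hV x : h x^-1 = (- h x)%R by have := hM x x^-1; rewrite mulgV h1; lia.
have hX x n : h (x ^+ n) = (n%:Z * h x)%R.
  by elim: n => [|n IH]; rewrite ?expg0 ?h1 ?mul0r // expgS hM IH; lia.
have h_power u : power_of_a u -> h u = 0%R.
  by move=> [k [l ->]]; rewrite hM hV !hX ha; lia.
pose pts c := map fst (task c) ++ map snd (task c).
have /choice[K KP] : forall c, exists k : nat,
    (forall x, x \in pts c -> (`|h x| < k%:Z)%R) /\
    forall n u, (k <= n)%N -> power_of_a u ->
      {in pts c &, forall x y, b ^+ n * x = u * (b ^+ n * y) -> x = y}.
  move=> c; have [n0 n0P] := b_power_separates_seq (pts c).
  exists (maxn n0 (\max_(x <- pts c) `|h x|%N).+1); split.
    move=> x xF; have : (`|h x|%N <= \max_(x <- pts c) `|h x|%N)%N.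
      exact: (@leq_bigmax_seq _ _ _ (fun x => `|h x|%N)).
    lia.
  by move=> n u; rewrite geq_max => /andP[le_n _]; exact: n0P.
(* Window m is the interval from start m to start m.+1, of radius K m./2 around
   center m; K bounds the heights of the task and exceeds the power of b needed
   to separate its points. *)
pose start m := (\sum_(j < m) 2 * K j./2)%N.
pose center m := (start m + K m./2)%N.
have startS m : start m.+1 = (start m + 2 * K m./2)%N by rewrite /start big_ord_recr.
pose tile m (z : int) := ((start m)%:Z <= z < (start m.+1)%:Z)%R.
have tile_inj m m' z : tile m z -> tile m' z -> m = m'.
  exact: (disjoint_tiling (K := fun j => 2 * K j./2)%N).
have tile_pt m x : x \in pts m./2 -> tile m ((center m)%:Z + h x)%R.
  by move=> /(KP _).1; rewrite /tile startS /center; lia.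
have sep m u x y : power_of_a u -> x \in pts m./2 -> y \in pts m./2 ->
    b ^+ center m * x = u * (b ^+ center m * y) -> x = y.
  by move=> pu xF yF; apply: (KP m./2).2 => //; rewrite leq_addl.
have half0 c : c.*2./2 = c by rewrite doubleK.
have half1 c : c.*2.+1./2 = c by rewrite -[c.*2.+1]/(true + c.*2)%N half_bit_double.
(* The orbits exchanged by the modification of t. The factor t^-1 on the target
   is undone by the translation by t that follows the exchange. *)
pose rel p q := exists c x y u, [/\ partial_injection (task c), (x, y) \in task c,
  power_of_a u, p = u * (b ^+ center c.*2 * x)
  & q = u * (t^-1 * (b ^+ center c.*2.+1 * y))].
have rel_tile p q : rel p q -> exists c, tile c.*2 (h p) /\ tile c.*2.+1 (h q).
  move=> [c [x [y [u [_ xy pu -> ->]]]]]; exists c.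
  rewrite !hM (h_power u pu) hV !hX hb ht oppr0 !add0r !mulr1.
  split; apply: tile_pt; rewrite ?half0 ?half1 mem_cat.
    by rewrite (map_f fst xy).
  by rewrite (map_f snd xy) orbT.
have rel_disj p q r : rel p q -> rel q r -> False.
  move=> /rel_tile[c [_ q1]] /rel_tile[c' [q2 _]].
  by have := tile_inj _ _ _ q1 q2; lia.
have same_task c x y u c' x' y' u' : (x, y) \in task c -> (x', y') \in task c' ->
    power_of_a u -> power_of_a u' ->
    u * (b ^+ center c.*2 * x) = u' * (b ^+ center c'.*2 * x') \/
    u * (t^-1 * (b ^+ center c.*2.+1 * y))
      = u' * (t^-1 * (b ^+ center c'.*2.+1 * y')) ->
    partial_injection (task c) -> [/\ c = c', x = x', y = y' & u = u'].
  move=> xy x'y' pu pu' eqs injc.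
  have puu : power_of_a (u^-1 * u').
    have := power_of_aF (power_of_aF power_of_a1 pu) (power_of_aF power_of_a1 pu').
    by rewrite !div1g invgK.
  have xF : x \in pts c by rewrite mem_cat (map_f fst xy).
  have x'F : x' \in pts c' by rewrite mem_cat (map_f fst x'y').
  have yF : y \in pts c by rewrite mem_cat (map_f snd xy) orbT.
  have y'F : y' \in pts c' by rewrite mem_cat (map_f snd x'y') orbT.
  case: eqs => [eq_src|eq_tgt].
    have cc : c = c'.
      apply: double_inj; apply: (tile_inj _ _ (h (u * (b ^+ center c.*2 * x)))).
        by rewrite !hM (h_power u pu) hX hb add0r mulr1; apply: tile_pt; rewrite half0.
      by rewrite eq_src !hM (h_power u' pu') hX hb add0r mulr1; apply: tile_pt;
        rewrite half0.
    rewrite -cc in x'y' x'F eq_src *.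
    have xx : x = x'.
      apply: (sep c.*2 _ _ _ puu); rewrite ?half0 //.
      by rewrite -mulgA -eq_src mulKg.
    have yy : y = y'.
      apply/eqP; have := injc _ _ xy x'y'; rewrite /= xx eqxx => <-.
      by [].
    by split=> //; move: eq_src; rewrite xx => /mulIg.
  have cc : c = c'.
    have := tile_inj c.*2.+1 c'.*2.+1
      (h (u * (t^-1 * (b ^+ center c.*2.+1 * y)))).
    rewrite {2}eq_tgt !hM (h_power u pu) (h_power u' pu') hV ht !hX hb oppr0 !add0r.
    rewrite !mulr1 => tt; suff : c.*2.+1 = c'.*2.+1 by lia.
    by apply: tt; apply: tile_pt; rewrite half1.
  rewrite -cc in x'y' y'F eq_tgt *.
  have eq_tgt' : b ^+ center c.*2.+1 * y = u^-1 * u' * (b ^+ center c.*2.+1 * y').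
    apply: (mulgI t^-1); apply: (mulgI u).
    rewrite eq_tgt [RHS]mulgA; have := power_of_a_t pu => /commuteV ->.
    by rewrite -mulgA -!mulgA mulVKg !mulgA (commuteV (power_of_a_t pu')).
  have yy : y = y' by apply: (sep c.*2.+1 _ _ _ puu); rewrite ?half1.
  have xx : x = x'.
    by apply/eqP; have := injc _ _ xy x'y'; rewrite /= yy eqxx => ->.
  by split=> //; move: eq_tgt; rewrite yy => /mulIg.
have rel_fun p q q' : rel p q -> rel p q' -> q = q'.
  move=> [c [x [y [u [inj xy pu -> ->]]]]] [c' [x' [y' [u' [_ xy' pu' eqp ->]]]]].
  by have [-> _ -> ->] := same_task _ _ _ _ _ _ _ _ xy xy' pu pu' (or_introl eqp) inj.
have rel_inj p p' q : rel p q -> rel p' q -> p = p'.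
  move=> [c [x [y [u [inj xy pu -> ->]]]]] [c' [x' [y' [u' [_ xy' pu' -> eqq]]]]].
  by have [-> -> _ ->] := same_task _ _ _ _ _ _ _ _ xy xy' pu pu' (or_intror eqq) inj.
have rel_a p q v : power_of_a v -> rel p q -> rel (v * p) (v * q).
  move=> pv [c [x [y [u [inj xy pu -> ->]]]]]; exists c, x, y, (v * u).
  split; rewrite ?mulgA //.
  have := power_of_aF pv (power_of_aF power_of_a1 pu).
  by rewrite div1g invgK.
have [s [sK s_dom s_cod s_id]] := partial_swap rel_fun rel_inj rel_disj.
have rel_aV p q : rel (a * p) q -> rel p (a^-1 * q).
  move=> /(rel_a _ _ a^-1); rewrite mulKg; apply.
  by have := power_of_aF power_of_a1 (power_of_aX 1); rewrite div1g.
have rel_aV' p q : rel q (a * p) -> rel (a^-1 * q) p.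
  move=> /(rel_a _ _ a^-1); rewrite mulKg; apply.
  by have := power_of_aF power_of_a1 (power_of_aX 1); rewrite div1g.
have s_a p : s (a * p) = a * s p.
  have [[q pq]|np] := pselect (exists q, rel p q).
    rewrite (s_dom _ _ pq); apply: s_dom; exact: (rel_a _ _ _ (power_of_aX 1)).
  have [[q qp]|nq] := pselect (exists q, rel q p).
    rewrite (s_cod _ _ qp); apply: s_cod; exact: (rel_a _ _ _ (power_of_aX 1)).
  rewrite [s p]s_id; first last.
  - by move=> q qp; apply: nq; exists q.
  - by move=> q pq; apply: np; exists q.
  apply: s_id => q.
    by move=> /rel_aV pq; apply: np; eexists; exact: pq.
  by move=> /rel_aV' pq; apply: nq; eexists; exact: pq.
(* All windows have nonnegative heights, so below height 0 nothing changes. *)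
have s_low p : (h p < 0)%R -> s p = p.
  move=> p_lt0; apply: s_id => q /rel_tile[c [p1 p2]]; rewrite /tile in p1 p2; lia.
pose left_bij (g : G) := bij_of (mulKg g) (mulVKg g).
pose s_bij := bij_of sK sK.
have [p|p|act [actG [act_a act_b act_t]]] :=
    @abt_action G (left_bij a) (left_bij b) (left_bij t * s_bij).
- rewrite /bij_fun /= !mulgA; congr (_ * _).
  apply: (mulgI b^-1); rewrite !mulgA abt_relation mulVg mul1g expg2.
  by [].
- by rewrite /bij_fun /= s_a !mulgA abt_commute.
have act_low g : exists L : nat, forall p, (h p < - L%:Z)%R -> act g p = g * p.
  have : [set g | exists L : nat, forall p, (h p < - L%:Z)%R -> act g p = g * p] g;
    last exact.
  apply: abt_ind; rewrite /= ?act_a ?act_b ?act_t.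
  - split=> [|x y [Lx xP] [Ly yP]].
      by exists 0%N => p _; rewrite actG.1 mul1g.
    exists (Lx + Ly + `|h y|)%N => p p_lt.
    have hq : h (y^-1 * p) = (h p - h y)%R by rewrite hM hV; lia.
    have yp : act y^-1 p = y^-1 * p.
      rewrite -[in LHS](mulVKg y p) -(yP (y^-1 * p)); last by rewrite hq; lia.
      by rewrite (actK actG).
    by rewrite actG.2 yp xP ?mulgA // hq; lia.
  - by exists 0%N.
  - by exists 0%N.
  - by exists 0%N => p p_lt; rewrite /bij_fun /= s_low.
exists act; split=> //.
- move=> k; split.
    have inj : injective (fun i : 'I_k => a ^+ i).
      by move=> i j /abt_A_inj /val_inj.
    apply: card_le_trans (subset_card_le (subsetT [set a ^+ i | i in [set: 'I_k]])).
    by rewrite (card_le_eqr (inj_card_eq (in2W inj))).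
  move=> x y x_inj y_inj.
  have [c cM] := task_surj [seq (x i, y i) | i <- enum 'I_k].
  have inj : partial_injection (task c).
    rewrite cM => _ _ /mapP[i _ ->] /mapP[j _ ->] /=.
    by rewrite (inj_eq x_inj) (inj_eq y_inj).
  exists ((b ^+ center c.*2.+1)^-1 * t * b ^+ center c.*2) => i.
  have act_bX n p : act (b ^+ n) p = b ^+ n * p.
    elim: n p => [|n IH] p; first by rewrite actG.1 mul1g.
    by rewrite expgS actG.2 IH act_b /bij_fun /= mulgA.
  have relxy : rel (b ^+ center c.*2 * x i) (t^-1 * (b ^+ center c.*2.+1 * y i)).
    exists c, (x i), (y i), 1; split; rewrite ?mul1g //; last exact: power_of_a1.
    by rewrite cM; apply/mapP; exists i; rewrite ?mem_enum.
  rewrite !actG.2 act_bX act_t {1}/bij_fun /= -/(bij_fun _) (s_dom _ _ relxy).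
  by rewrite mulVKg -act_bX (actK actG).
- move=> g F; have [L LP] := act_low g.
  pose M := (L + \sum_(x <- F) `|h x|).+1%N.
  have hM' : h (b ^+ M)^-1 = (- M%:Z)%R by rewrite hV hX hb mulr1.
  exists (b ^+ M)^-1.
    apply/negP => MF; have : (`|h (b ^+ M)^-1| <= \sum_(x <- F) `|h x|)%N.
      by rewrite (big_rem _ MF) /= leq_addr.
    by rewrite hM' /M; lia.
  move=> g1; rewrite LP; last by rewrite hM' /M; lia.
  by rewrite -[X in _ != X]mul1g (inj_eq (@mulIg _ _)).
Qed.

Theorem abt_highly_transitive : highly_transitive abt_group.
Proof.
have [act [actG ht moved]] := abt_highly_transitive_action.
exists G, act; split=> // g g_id; apply/eqP; apply: contrapT => /negP g1.
by have [z _ /(_ g1)] := moved g [::]; rewrite g_id eqxx.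
Qed.

Theorem abt_mixed_identity_free : mixed_identity_free abt_group.
Proof.
have [act [actG ht moved]] := abt_highly_transitive_action.
exact: highly_transitive_mixed_identity_free ht.
Qed.

Theorem abt_not_acylindrically_hyperbolic (R : realType) :
  ~ acylindrically_hyperbolic R abt_group.
Proof.
apply: (distorted_commensurated_not_acylindrically_hyperbolic
  abt_A_inj abt_relation) => g.
pose S := [set g : G | exists p q, [/\ (0 < p)%N, (0 < q)%N &
  a ^+ p * g = g * a ^+ q]].
have conjX (x : G) p q n : a ^+ p * x = x * a ^+ q ->
    a ^+ (p * n) * x = x * a ^+ (q * n).
  move=> comm; rewrite !expgnA; elim: n => [|n IH]; first by rewrite mulg1 mul1g.
  by rewrite !expgSr -mulgA comm !mulgA IH.
suff: S g by [].
apply: abt_ind.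
- split=> [|x y [p [q [p0 q0 eqx]]] [p' [q' [p'0 q'0 eqy]]]].
    by exists 1%N, 1%N; rewrite mulg1 mul1g.
  exists (p * q')%N, (p' * q)%N; rewrite !muln_gt0 p0 q0 p'0 q'0; split=> //.
  have eqy' : a ^+ q' / y = y^-1 * a ^+ p'.
    by apply: (mulgI y); rewrite mulVKg !mulgA -eqy mulgK.
  rewrite mulgA (conjX _ _ _ _ eqx) -!mulgA; congr (_ * _).
  rewrite [(q * q')%N]mulnC; have := conjX y^-1 q' p' q; apply.
  exact: eqy'.
- by exists 1%N, 1%N.
- exists 1%N, 2%N; split=> //; apply: (mulgI b^-1).
  by rewrite mulKg mulgA abt_relation.
- by exists 1%N, 1%N; split=> //; exact: abt_commute.
Qed.

End HighTransitivity.

(** * Locally nilpotent-by-cyclic groups that are not 2-transitive *)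

Section NotTwoTransitive.

(** The relations E k stand for congruence modulo a descending central series
    of N whose factors have exponent 3, and the L B for an exhaustion of N by
    subgroups on each of which this series terminates. *)

Variables (G : groupType) (tau : G -> int).
Hypothesis tauM : {morph tau : x y / x * y >-> (x + y)%R}.
Local Notation N := [set g | tau g = 0%R].
Variables (E : nat -> G -> G -> Prop) (L : nat -> set G).
Hypothesis E_sym : forall k g h, E k g h -> E k h g.
Hypothesis E_trans : forall k g h l, E k g h -> E k h l -> E k g l.
Hypothesis E_refl : forall k g, E k g g.
Hypothesis E0 : forall g h, N g -> N h -> E 0 g h.
Hypothesis E_mul : forall k g g' h h', N g -> N g' -> N h -> N h' ->
  E k g g' -> E k h h' -> E k (g * h) (g' * h').
Hypothesis E_central : forall k g h, N g -> N h -> E k g 1 ->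
  E k.+1 (g * h) (h * g).
Hypothesis E_cube : forall k g, N g -> E k g 1 -> E k.+1 (g ^+ 3) 1.
Hypothesis L_subgroup : forall B, is_subgroup (L B).
Hypothesis L_mono : forall B B', (B <= B')%N -> L B `<=` L B'.
Hypothesis L_N : forall g, N g <-> exists B, L B g.
Hypothesis L_sep : forall B, exists k, forall g h, L B g -> L B h ->
  E k g h -> g = h.

Let tau1 : tau 1 = 0%R.
Proof. by have := tauM 1 1; rewrite mulg1; lia. Qed.

Let tauV x : tau x^-1 = (- tau x)%R.
Proof. by have := tauM x x^-1; rewrite mulgV tau1; lia. Qed.

Let tauX x n : tau (x ^+ n) = (n%:Z * tau x)%R.
Proof. by elim: n => [|n IH]; rewrite ?expg0 ?tau1 ?mul0r // expgS tauM IH; lia. Qed.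

Let tauJ x y : tau (x ^ y) = tau x.
Proof. by rewrite /conjg !tauM tauV; lia. Qed.

Let sN : is_subgroup N.
Proof. by split=> [|x y] /=; rewrite ?tau1 ?tauM ?tauV // => -> ->. Qed.

(** Cubing improves the agreement with 1 by one step, and finitely many steps
    suffice. *)
Lemma kernel_odd_order g : N g -> exists m, g ^+ (3 ^ m) = 1.
Proof.
move=> Ng; have [B LB] := (L_N g).1 Ng; have [k sep] := L_sep B.
exists k; apply: sep; [exact: subgroupX | exact: subgroup1|].
elim: k => [|k IH]; first exact: E0.
by rewrite expnSr expgnA; apply: E_cube => //; exact: (subgroupX _ sN).
Qed.

Lemma E_inv k g h : N g -> N h -> E k g h -> E k g^-1 h^-1.
Proof.
move=> Ng Nh gh; have NV := subgroupV sN; have NM := subgroupM sN.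
rewrite -[X in E _ X]mulg1 -(mulgV h) -{2}[h^-1]mul1g -[X in E _ _ (X * _)](mulVg g).
rewrite -mulgA; apply: E_mul => //; [exact: NV|exact: NV|..].
- by apply: (NM _ _) => //; exact: NV.
- by apply: (NM _ _) => //; exact: NV.
apply: E_mul => //; [exact: NV|exact: NV|exact: E_sym].
Qed.

(** Write g = g' al with al central modulo the next relation: al then drops out
    of the commutator. *)
Lemma E_commg_l k g g' h : N g -> N g' -> N h -> E k g g' ->
  E k.+1 [~ g, h] [~ g', h].
Proof.
have NV := subgroupV sN; have NM := subgroupM sN.
move=> Ng Ng' Nh gg'; pose al := g'^-1 * g.
have Nal : N al by apply: (NM _ _) => //; exact: NV.
have al1 : E k al 1.
  by rewrite -(mulVg g'); apply: E_mul => //; exact: NV.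
have gE : g = g' * al by rewrite mulVKg.
have Ncomm : N [~ g', h].
  by rewrite /commg /conjg; apply: (NM _ _ (NV _ Ng'));
    apply: (NM _ _); [exact: NV|exact: NM].
apply: (@E_trans _ _ (al^-1 * ([~ g', h] * al))); last first.
  rewrite -[X in E _ _ X](mulKg al).
  apply: E_mul; [exact: NV|exact: NV|exact: NM|exact: NM|exact: E_refl|].
  exact/E_sym/E_central.
have -> : al^-1 * ([~ g', h] * al) = (h * g)^-1 * (g' * (h * al)).
  by rewrite gE /commg /conjg !invgM !mulgA.
have -> : [~ g, h] = (h * g)^-1 * (g' * (al * h)).
  by rewrite [g' * _]mulgA -gE /commg /conjg !invgM !mulgA.
apply: E_mul; rewrite ?invgM.
- by apply: (NM _ _); exact: NV.
- by apply: (NM _ _); exact: NV.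
- by apply: (NM _ _) => //; exact: NM.
- by apply: (NM _ _) => //; exact: NM.
- exact: E_refl.
by apply: E_mul => //; [exact: NM|exact: NM|exact: E_central].
Qed.

Lemma E_commg k g g' h h' : N g -> N g' -> N h -> N h' ->
  E k g g' -> E k h h' -> E k.+1 [~ g, h] [~ g', h'].
Proof.
have NV := subgroupV sN; have NM := subgroupM sN.
have Ncomm x y : N x -> N y -> N [~ x, y].
  by move=> Nx Ny; rewrite /commg /conjg; apply: (NM _ _ (NV _ Nx)); apply: (NM _ _);
    [exact: NV|exact: NM].
move=> Ng Ng' Nh Nh' gg' hh'; apply: E_trans (E_commg_l Ng Ng' Nh gg') _.
rewrite -[X in E _ X]invgR -[X in E _ _ X]invgR.
by apply: E_inv; [exact: Ncomm|exact: Ncomm|exact: E_commg_l].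
Qed.

(** In a nilpotent group F, a subgroup that generates F together with a
    commutator is already F. Here only finitely many elements of P are
    involved, so they lie with x and y in some L B, on which the relations E k
    eventually separate points. The induction on k improves an approximation of
    [~ x, y] by elements of P: x and y are then approximated by elements x', y'
    of P, and [~ x', y'] agrees with [~ x, y] one step further. *)
Lemma commutator_generation (P : set G) x y : is_subgroup P -> P `<=` N ->
  N [~ x, y] -> generated (P `|` [set [~ x, y]]) x ->
  generated (P `|` [set [~ x, y]]) y -> P [~ x, y].
Proof.
move=> sP PN; set c := [~ x, y] => Nc genx geny.
have [B0 LB0c] := (L_N c).1 Nc.
pose F B := generated ((P `&` L B) `|` [set c]).
have F_mono B B' : (B <= B')%N -> F B `<=` F B'.
  move=> BB'; apply: generated_min; first exact: generated_subgroup.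
  move=> g [[Pg LBg]|->]; apply: sub_generated; [left|by right].
  by split=> //; exact: (L_mono BB').
pose U := [set g | exists2 B, (B0 <= B)%N & F B g].
have genU : generated (P `|` [set c]) `<=` U.
  apply: generated_min.
    split; first by exists B0 => //; exact: (subgroup1 (generated_subgroup _)).
    move=> g h [B B0B FBg] [B' B0B' FB'h].
    exists (maxn B B'); first by rewrite leq_max B0B.
    apply: (generated_subgroup _).2; first exact: F_mono (leq_maxl _ _) _ FBg.
    exact: F_mono (leq_maxr _ _) _ FB'h.
  move=> g [Pg|->]; last by exists B0 => //; apply: sub_generated; right.
  have [B LBg] := (L_N g).1 (PN _ Pg).
  exists (maxn B0 B); first exact: leq_maxl.
  by apply: sub_generated; left; split=> //; exact: (L_mono (leq_maxr _ _)).
have [B1 B01 F1x] := genU _ genx; have [B2 B02 F2y] := genU _ geny.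
set B := maxn B1 B2.
have Fx : F B x by exact: F_mono (leq_maxl _ _) _ F1x.
have Fy : F B y by exact: F_mono (leq_maxr _ _) _ F2y.
have LBc : L B c by apply: L_mono LB0c; rewrite leq_max B01.
have LB_N g : L B g -> N g by move=> LBg; apply/L_N; exists B.
have sLB := L_subgroup B.
have [k sep] := L_sep B.
suff [kap [Pkap Lkap] kapc] : exists2 kap, (P `&` L B) kap & E k kap c.
  by rewrite -(sep _ _ Lkap LBc kapc).
elim: k {sep} => [|k [kap [Pkap Lkap] kapc]].
  exists 1; first by split; exact: subgroup1.
  by apply: E0 => //; exact: subgroup1.
pose S := [set g | L B g /\ exists2 kap, (P `&` L B) kap & E k kap g].
have FS : F B `<=` S.
  apply: generated_min; last first.
    move=> g [[Pg Lg]|->]; split=> //; last by exists kap.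
    by exists g => //; exact: E_refl.
  split.
    split; first exact: subgroup1.
    by exists 1; [split; exact: subgroup1|exact: E_refl].
  move=> g h [Lg [g' [Pg' Lg'] gg']] [Lh [h' [Ph' Lh'] hh']]; split.
    exact: sLB.2.
  exists (g' / h'); first by split; [exact: sP.2|exact: sLB.2].
  apply: E_mul => //; [exact: LB_N|exact: LB_N|..].
  - by apply: LB_N; exact: subgroupV.
  - by apply: LB_N; exact: subgroupV.
  by apply: E_inv => //; exact: LB_N.
have [Lx [x' [Px' Lx'] xx']] := FS _ Fx.
have [Ly [y' [Py' Ly'] yy']] := FS _ Fy.
exists [~ x', y']; last by apply: E_commg => //; exact: LB_N.
have comm_in H : is_subgroup H -> H x' -> H y' -> H [~ x', y'].
  move=> sH Hx' Hy'; rewrite /commg /conjg.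
  by do ![apply: (subgroupM sH) => // | apply: (subgroupV sH) => //].
by split; apply: comm_in.
Qed.

(** The stabilizer H of x acts transitively on the other points, and P is its
    intersection with N. The element k of H sends n x to n^-1 x. *)
Theorem not_two_transitive (n0 : G) (T : Type) (act : G -> T -> T) :
  N n0 -> n0 <> 1 ->
  is_group_action act -> faithful_action act ->
  ~ (forall x y x' y', x <> y -> x' <> y' ->
       exists g, act g x = x' /\ act g y = y').
Proof.
move=> Nn0 n0_1 [act1 actM] faith trans2.
have actVK g x : act g^-1 (act g x) = x by rewrite -actM mulVg act1.
have actKV g x : act g (act g^-1 x) = x by rewrite -actM mulgV act1.
have [x0 n0x0] : exists x0, act n0 x0 <> x0.
  by apply: contrapT => nx; apply: n0_1; apply: faith => x; apply: contrapT => nxx;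
    apply: nx; exists x.
have transN y z : exists2 n, N n & act n y = z.
  have [->|yz] := pselect (y = z); first by exists 1.
  have [g [gx gy]] := trans2 _ _ _ _ (not_eq_sym n0x0) yz.
  exists (n0 ^ g^-1); first by rewrite /= tauJ.
  by rewrite /conjg invgK !actM -gx actVK -gy.
set x := x0; have [n Nn nx] := transN x (act n0 x).
have {nx} nx : act n x <> x by rewrite nx.
pose H := [set g | act g x = x].
have sH : is_subgroup H.
  by split=> [|g h]; rewrite /H /= ?act1 // actM => gx hx; rewrite -{1}hx actVK.
pose P := [set g | N g /\ H g].
have sP : is_subgroup P.
  split=> [|g h [Ng Hg] [Nh Hh]]; first by split; [exact: tau1|exact: act1].
  by split; [exact: sN.2|exact: sH.2].
have PJ g q : H g -> P q -> P (q ^ g).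
  move=> Hg [Nq Hq]; split; first by rewrite /= tauJ.
  rewrite /conjg; apply: (subgroupM sH); first exact: subgroupV.
  exact: subgroupM.
have transH y z : y <> x -> z <> x -> exists2 g, H g & act g y = z.
  move=> yx zx; have [g [gx gy]] := trans2 _ _ _ _ (not_eq_sym yx) (not_eq_sym zx).
  by exists g.
have nVx : act n^-1 x <> x by move=> e; apply: nx; rewrite -{1}e actKV.
have [k Hk knx] := transH _ _ nx nVx.
have coset_P u v : N u -> N v -> act u x = act v x -> P (u^-1 * v).
  move=> Nu Nv uv; split; last by rewrite /H /= actM -uv actVK.
  by apply: (subgroupM sN) => //; exact: (subgroupV sN).
have kn : P ((n ^ k^-1)^-1 * n^-1).
  apply: coset_P; [by rewrite /= tauJ|exact: subgroupV|].
  have Hk' := subgroupV sH Hk.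
  by rewrite /conjg invgK !actM Hk' knx.
(* If k is in N, then n k exchanges x and n x. *)
have [tauk|tauk] := eqVneq (tau k) 0%R.
  have Nnk : N (n * k) by exact: (subgroupM sN).
  have [m nk_odd] := kernel_odd_order Nnk.
  have nkx : act (n * k) x = act n x by rewrite actM Hk.
  have nknx : act (n * k) (act n x) = x by rewrite actM knx actKV.
  have nk_iter j : act ((n * k) ^+ j) x = if odd j then act n x else x.
    elim: j => [|j IH]; first by rewrite expg0 act1.
    by rewrite expgS actM IH /=; case: odd.
  apply: nx; have := nk_iter (3 ^ m)%N.
  by rewrite nk_odd act1 oddX orbT => <-.
pose M := generated (P `|` [set n]).
have sM : is_subgroup M by exact: generated_subgroup.
have PM q : P q -> M q by move=> Pq; apply: sub_generated; left.
have Mn : M n by apply: sub_generated; right.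
have MN : M `<=` N.
  by apply: generated_min => // g [[Ng _]|->].
have genJ (A : set G) g u (B : set G) : is_subgroup B ->
    (forall y, A y -> B (y ^ g)) -> generated A u -> B (u ^ g).
  move=> sB AB; apply: (generated_min (H := [set u | B (u ^ g)])) => //.
  split; first by rewrite /= conj1g; exact: subgroup1.
  by move=> y z By Bz; rewrite /= conjMg conjVg; exact: sB.2.
(* St is only a monoid at first. Since k and its inverse belong to it, so do
   the inverses of all its elements fixing x: modulo P, a power of such an
   element is a power of k. *)
pose St := [set g | forall y, M y -> M (y ^ g)].
have StM g h : St g -> St h -> St (g * h).
  by move=> Sg Sh y My; rewrite conjgM; apply: Sh; exact: Sg.
have StX g j : St g -> St (g ^+ j).
  move=> Sg; elim: j => [|j IH]; first by move=> y; rewrite expg0 conjg1.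
  by rewrite expgS; exact: StM.
have StP q : P q -> St q.
  move=> Pq y My; rewrite /conjg; have Mq := PM _ Pq.
  by do ![apply: (subgroupM sM) => // | apply: (subgroupV sM) => //].
have St_H g : H g -> M (n ^ g) -> St g.
  move=> Hg Mng y; apply: genJ => // u [Pu|->] //.
  by apply: PM; exact: PJ.
have nE : n ^ k^-1 = (((n ^ k^-1)^-1 * n^-1) * n)^-1 by rewrite mulgVK invgK.
have StkV : St k^-1.
  apply: St_H; first exact: subgroupV.
  rewrite nE; apply: (subgroupV sM); apply: (subgroupM sM) => //; exact: PM.
have Stk : St k.
  apply: St_H => //.
  have -> : n ^ k = (((n ^ k^-1)^-1 * n^-1) ^ k)^-1 * n^-1.
    rewrite conjMg !conjVg invgM !invgK -conjgM mulVg conjg1.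
    by rewrite mulgK.
  apply: (subgroupM sM); apply: (subgroupV sM) => //.
  by apply: PM; exact: PJ.
have StV g : H g -> St g -> St g^-1.
  move=> Hg Sg.
  pose k' := if (0 <= tau k)%R == (0 <= tau g)%R then k^-1 else k.
  have Hk' : H k' by rewrite /k'; case: ifP => // _; exact: (subgroupV sH).
  have Stk' : St k' by rewrite /k'; case: ifP.
  pose q := g ^+ `|tau k| * k' ^+ `|tau g|.
  have Pq : P q.
    split; last by apply: (subgroupM sH); exact: subgroupX.
    rewrite /q /= tauM !tauX /k'; case: ifP; rewrite ?tauV; lia.
  have -> : g^-1 = g ^+ `|tau k|.-1 * (k' ^+ `|tau g| * q^-1).
    rewrite /q invgM mulVKg.
    apply: (mulIg (g ^+ `|tau k|)); rewrite mulgVK.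
    have {1}-> : `|tau k|%N = `|tau k|.-1.+1 by rewrite prednK // absz_gt0.
    by rewrite expgS mulKg.
  apply: (StM _ _ _ _); first exact: StX.
  apply: (StM _ _ _ _); first exact: StX.
  by apply: StP; exact: subgroupV.
(* Some g fixing x sends z x to n x, hence n lies in the conjugate by g of the
   group generated by P and z. *)
have M_min z : M z -> ~ P z -> generated (P `|` [set z]) n.
  move=> Mz nPz; set Mz' := generated _.
  have sMz' : is_subgroup Mz' by exact: generated_subgroup.
  have zx : act z x <> x by move=> zx; apply: nPz; split=> //; exact: MN.
  have [g Hg gzx] := transH _ _ zx nx.
  have Pzn : P ((z ^ g^-1)^-1 * n).
    apply: coset_P => //; first by rewrite /= tauJ; exact: MN.
    by have Hg' := subgroupV sH Hg; rewrite /conjg invgK !actM Hg' gzx.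
  have ng : Mz' (n ^ g).
    have -> : n ^ g = z * ((z ^ g^-1)^-1 * n) ^ g.
      by rewrite conjMg conjVg conjgKV mulVKg.
    apply: (subgroupM sMz'); apply: sub_generated; first by right.
    by left; exact: PJ.
  have Mz'M : Mz' `<=` M.
    by apply: generated_min => // u [/PM|->].
  have Sg : St g by apply: St_H => //; exact: Mz'M.
  have MnV := StV _ Hg Sg _ Mn.
  rewrite -[n](conjgKV g); move: MnV; apply: genJ => // u [Pu|->] //.
  by apply: sub_generated; left; exact: PJ.
(* Otherwise the commutator would generate M together with P. *)
have comm_P y z : M y -> M z -> P [~ y, z].
  move=> My Mz; apply: contrapT => nPc.
  have Mc : M [~ y, z].
    rewrite /commg /conjg.
    by do ![apply: (subgroupM sM) => // | apply: (subgroupV sM) => //].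
  have Mgen : M `<=` generated (P `|` [set [~ y, z]]).
    apply: generated_min; first exact: generated_subgroup.
    move=> u [Pu|->]; last exact: M_min.
    by apply: sub_generated; left.
  apply: nPc; apply: commutator_generation => //; last 2 first.
  - exact: Mgen.
  - exact: Mgen.
  - by move=> u [].
  - exact: MN.
(* n normalizes P, so P fixes n x, and then every point since the stabilizer of
   x normalizes P as well. *)
have P1 q : P q -> q = 1.
  move=> Pq; apply: faith => y.
  have [->|yx] := pselect (y = x); first exact: Pq.2.
  have [g Hg <-] := transH _ _ nx yx.
  have Pqg := PJ _ _ Hg Pq.
  have [_ Hqgn] : P ((q ^ g) ^ n).
    have -> : (q ^ g) ^ n = q ^ g * [~ q ^ g, n] by rewrite /commg mulVKg.
    by apply: (subgroupM sP) => //; apply: comm_P => //; exact: PM.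
  have -> : act q (act g (act n x)) = act (g * n * ((q ^ g) ^ n)) x.
    rewrite -!actM; congr (act _ x).
    by rewrite /conjg !mulgA mulgK mulgV mul1g.
  by rewrite actM Hqgn actM.
have kn' : n ^ k^-1 = n^-1 by have := P1 _ kn => /(canRL (mulVKg _)); rewrite mulg1.
have k2_fix y : act (k * k) y = y.
  have Hk2 : H (k * k) by exact: subgroupM.
  have [->|yx] := pselect (y = x); first exact: Hk2.
  have [g Hg <-] := transH _ _ nx yx.
  have k2g : commute (k * k) g.
    apply/commgP/eqP/P1; split; last first.
      rewrite /commg /conjg.
      by do ![apply: (subgroupM sH) => // | apply: (subgroupV sH) => //].
    by rewrite /commg /conjg /= !tauM !tauV !tauM; lia.
  have k2n : commute (k * k) n.
    have nk : n ^ k = n^-1.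
      by rewrite -[LHS]invgK -conjVg -kn' -conjgM mulVg conjg1.
    by apply/commute_sym/commgP; rewrite -conjg_fix conjgM nk conjVg nk invgK.
  by rewrite -[LHS]actM k2g actM -[act _ (act n x)]actM k2n actM Hk2.
have /(congr1 tau) : k * k = 1 by exact: faith.
by rewrite tauM tau1; lia.
Qed.

End NotTwoTransitive.

(** * Power series in noncommuting letters, truncated to good words *)

Section Convolution.
Variable A : Type.
Local Open Scope ring_scope.
Local Notation K := 'F_3.
Implicit Types (f g h : seq A -> K) (U V W : seq A).

Definition delta : seq A -> K := fun W => (nilp W)%:R.

(** The convolution over all factorizations of W, written as a recursion on W
    so that associativity is a plain induction. *)
Fixpoint convol f g W : K :=
  f [::] * g W +
  if W is x :: W' then convol (fun V => f (x :: V)) g W' else 0.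

Lemma eq_convol f f' g g' W :
  (forall U V, U ++ V = W -> f U = f' U /\ g V = g' V) ->
  convol f g W = convol f' g' W.
Proof.
elim: W f f' => [|x W IH] f f' fg /=; have [-> ->] := fg [::] _ (erefl _) => //.
by congr (_ + _); apply: IH => U V UV; apply: (fg (x :: U)); rewrite /= UV.
Qed.

Lemma convol_eq0 f g W :
  (forall U V, U ++ V = W -> f U * g V = 0) -> convol f g W = 0.
Proof.
elim: W f => [|x W IH] f fg /=; rewrite (fg [::]) // add0r //.
by apply: IH => U V UV; apply: (fg (x :: U)); rewrite /= UV.
Qed.

(** The factorizations of U ++ V are indexed by the length of their left part.
    *)
Lemma convol_single f g U V :
  (forall U' V', U' ++ V' = U ++ V -> size U' <> size U -> f U' * g V' = 0) ->
  convol f g (U ++ V) = f U * g V.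
Proof.
elim: U f => [|x U IH] f fg /=.
  case: V fg => [|x V] fg /=; first by rewrite addr0.
  rewrite convol_eq0 ?addr0 // => U' V' UV; apply: (fg (x :: U')) => //=.
  by rewrite UV.
rewrite (fg [::]) // add0r IH // => U' V' UV ne; apply: (fg (x :: U')).
  by rewrite /= UV.
by move=> [].
Qed.

Lemma convol_deltal g : convol delta g = g.
Proof.
apply/funext => W; rewrite (@convol_single delta g [::]) ?mul1r //.
by move=> [|x U] V // _ _; rewrite mul0r.
Qed.

Lemma convol_deltar f : convol f delta = f.
Proof.
apply/funext => W; rewrite -[in LHS](cats0 W) convol_single ?mulr1 //.
move=> U [|x V]; last by rewrite mulr0.
by rewrite !cats0 => ->.
Qed.

Lemma convolDl f g h W :
  convol (fun V => f V + g V) h W = convol f h W + convol g h W.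
Proof.
elim: W f g => [|x W IH] f g /=; first by rewrite !addr0 mulrDl.
by rewrite IH mulrDl addrACA.
Qed.

Lemma convolZl c f g W : convol (fun V => c * f V) g W = c * convol f g W.
Proof.
elim: W f => [|x W IH] f /=; first by rewrite !addr0 mulrA.
by rewrite IH mulrDr mulrA.
Qed.

Lemma convolA f g h : convol f (convol g h) = convol (convol f g) h.
Proof.
apply/funext => W; elim: W f g => [|x W IH] f g /=.
  by rewrite !addr0 mulrA.
rewrite convolDl convolZl -IH; ring.
Qed.

End Convolution.

Section GoodWords.
Local Open Scope ring_scope.
Local Notation K := 'F_3.
Local Notation series := (seq int -> K).
Implicit Types (f g h : series) (U V W : seq int).

Definition spread (b : seq int) : bool :=
  has (fun x => has (fun y => (size b)%:Z <= y - x + 1) b) b.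

(** Goodness is inherited by factors, so the bad words span an ideal. It is
    invariant under translation, rules out two equal adjacent letters, and
    bounds the length of words over a bounded set of letters; yet letters may
    alternate in any order if their distances exceed the length of the word. *)
Definition good W : bool :=
  `[< forall U b V, W = U ++ b ++ V -> b != [::] -> spread b >].

Definition in_radius (B : nat) : pred int := fun z => (`|z| <= B)%N.

Lemma good_nil : good [::].
Proof. by apply/asboolP => -[|? ?] [|? ?]. Qed.

Lemma spread_seq1 z : spread [:: z].
Proof. by rewrite /spread /= subrr. Qed.

Lemma good_seq1 z : good [:: z].
Proof.
apply/asboolP => -[|x U] [|y b] V //=; last by case; case: U.
by case: b => [[<- _] _|? ? []] //; exact: spread_seq1.
Qed.

Lemma good_catl U V : good (U ++ V) -> good U.
Proof.
move=> /asboolP gUV; apply/asboolP => U' b V' UE; apply: (gUV U' b (V' ++ V)).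
by rewrite UE -!catA.
Qed.

Lemma good_catr U V : good (U ++ V) -> good V.
Proof.
move=> /asboolP gUV; apply/asboolP => U' b V' VE; apply: (gUV (U ++ U') b V').
by rewrite VE -!catA.
Qed.

(** This makes each letter square to zero, so that 1 + x and 1 - x are inverse
    to each other. *)
Lemma good_double z W : ~~ good [:: z, z & W].
Proof.
apply/asboolPn => /(_ [::] [:: z; z] W erefl isT).
by rewrite /spread /= subrr.
Qed.

(** The source of local finiteness. *)
Lemma good_size B W : good W -> all (in_radius B) W -> (size W <= 2 * B + 1)%N.
Proof.
case: W => // z W /asboolP /(_ [::] (z :: W) [::]); rewrite cats0.
move=> /(_ erefl isT) /hasP[x xW /hasP[y yW xy]] /allP wB.
have := wB _ xW; have := wB _ yW; rewrite /in_radius => By Bx; lia.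
Qed.

Definition shift_word (k : int) W := [seq z + k | z <- W].

Lemma shift_word0 W : shift_word 0 W = W.
Proof. by rewrite /shift_word -[RHS]map_id; apply: eq_map => z; rewrite addr0. Qed.

Lemma shift_wordD k l W : shift_word k (shift_word l W) = shift_word (k + l) W.
Proof.
by rewrite /shift_word -map_comp; apply: eq_map => z /=; rewrite addrAC -addrA.
Qed.

Lemma shift_wordK k : cancel (shift_word k) (shift_word (- k)).
Proof. by move=> W; rewrite shift_wordD addNr shift_word0. Qed.

Lemma shift_word_cat k U V :
  shift_word k (U ++ V) = shift_word k U ++ shift_word k V.
Proof. exact: map_cat. Qed.

Lemma spread_shift k W : spread (shift_word k W) = spread W.
Proof.
rewrite /spread has_map size_map; apply: eq_has => x /=; rewrite has_map.
by apply: eq_has => y /=; congr (_ <= _); lia.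
Qed.

Lemma good_shift k W : good (shift_word k W) = good W.
Proof.
have imp l V : good V -> good (shift_word l V).
  move=> /asboolP gV; apply/asboolP => U b V' VE b0.
  rewrite -(spread_shift (- l)); apply: (gV (shift_word (- l) U) _ (shift_word (- l) V')).
    by rewrite -!shift_word_cat -VE shift_wordK.
  by case: b b0 {VE}.
by apply/idP/idP => [/(imp (- k))|/imp //]; rewrite shift_wordK.
Qed.

Definition translate (k : int) f : series := fun W => f (shift_word (- k) W).

Lemma translate0 f : translate 0 f = f.
Proof. by apply/funext => W; rewrite /translate oppr0 shift_word0. Qed.

Lemma translateD k l f : translate k (translate l f) = translate (k + l) f.
Proof.
by apply/funext => W; rewrite /translate shift_wordD; congr (f (shift_word _ W)); lia.
Qed.

Lemma translate_delta k : translate k (@delta int) = @delta int.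
Proof. by apply/funext => -[]. Qed.

Lemma translate_convol k f g :
  translate k (convol f g) = convol (translate k f) (translate k g).
Proof.
apply/funext => W; elim: W f => [|x W IH] f //=.
by rewrite /translate /=; congr (_ + _); exact: (IH (fun V => f (x - k :: V))).
Qed.

Definition truncate f : series := fun W => if good W then f W else 0.

Lemma truncate_translate k f : truncate (translate k f) = translate k (truncate f).
Proof. by apply/funext => W; rewrite /truncate /translate good_shift. Qed.

Lemma truncate_convol_left f g :
  truncate (convol (truncate f) g) = truncate (convol f g).
Proof.
apply/funext => W; rewrite /truncate; case: ifP => // gW.
by apply: eq_convol => U V UV; rewrite (good_catl (V := V)) // UV.
Qed.

Lemma truncate_convol_right f g :
  truncate (convol f (truncate g)) = truncate (convol f g).
Proof.
apply/funext => W; rewrite /truncate; case: ifP => // gW.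
by apply: eq_convol => U V UV; rewrite (good_catr (U := U)) // UV.
Qed.

(** * The group of truncated series with constant term 1, extended by translation *)

Definition local B f := forall W, ~~ all (in_radius B) W -> f W = 0.

Definition shift_series_axiom (p : series * int) : Prop :=
  [/\ p.1 [::] = 1, truncate p.1 = p.1 & exists B, local B p.1].

(** The pair (u, k) stands for the translation by k followed by multiplication
    by u, and these pairs multiply by the semidirect product law. The support
    condition keeps each element inside the group on finitely many letters. *)
Definition shift_series := {p | shift_series_axiom p}.
HB.instance Definition _ := gen_eqMixin shift_series.
HB.instance Definition _ := gen_choiceMixin shift_series.

Definition coef (p : shift_series) : series := (sval p).1.
Definition shift_deg (p : shift_series) : int := (sval p).2.

Lemma shift_seriesP p q : coef p = coef q -> shift_deg p = shift_deg q -> p = q.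
Proof.
case: p q => [[f k] fP] [[g l] gP]; rewrite /coef /shift_deg /= => fg kl.
by apply: eq_exist; rewrite fg kl.
Qed.

Lemma coef_nil p : coef p [::] = 1. Proof. by case: (svalP p). Qed.

Lemma coef_truncate p : truncate (coef p) = coef p.
Proof. by case: (svalP p). Qed.

Lemma coef_local p : exists B, local B (coef p).
Proof. by case: (svalP p). Qed.

Lemma coef_good p W : coef p W != 0 -> good W.
Proof. by rewrite -coef_truncate /truncate; case: ifP; rewrite ?eqxx. Qed.

Lemma local_mono B B' f : (B <= B')%N -> local B f -> local B' f.
Proof.
move=> BB' fB W nW; apply: fB; apply: contra nW; apply: sub_all => z.
by rewrite /in_radius => /leq_trans; apply.
Qed.

Lemma local_convol B f g : local B f -> local B g -> local B (convol f g).
Proof.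
move=> fB gB W nW; apply: convol_eq0 => U V UV.
move: nW; rewrite -UV all_cat negb_and => /orP[/fB ->|/gB ->].
  by rewrite mul0r.
by rewrite mulr0.
Qed.

Lemma local_translate B k f : local B f -> local (B + `|k|) (translate k f).
Proof.
move=> fB W nW; apply: fB; apply: contra nW; rewrite all_map; apply: sub_all => z.
by rewrite /in_radius /=; lia.
Qed.

Lemma local_truncate B f : local B f -> local B (truncate f).
Proof. by move=> fB W nW; rewrite /truncate fB // if_same. Qed.

Fact delta_axiom k : shift_series_axiom (@delta int, k).
Proof.
split=> //=; last by exists 0%N => -[].
apply/funext => -[|x W]; first by rewrite /truncate good_nil.
by rewrite /truncate if_same.
Qed.

Fact convol_axiom p q :
  shift_series_axiom (truncate (convol (coef p) (translate (shift_deg p) (coef q))),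
                      shift_deg p + shift_deg q).
Proof.
split=> /=.
- by rewrite /truncate good_nil /= addr0 /translate /= !coef_nil mulr1.
- by apply/funext => W; rewrite /truncate; case: (good W).
have [B fB] := coef_local p; have [B' gB] := coef_local q.
exists (maxn B (B' + `|shift_deg p|)); apply: local_truncate; apply: local_convol.
  exact: (local_mono (leq_maxl _ _) fB).
exact: (local_mono (leq_maxr _ _) (local_translate gB)).
Qed.

Definition shift_elt k : shift_series := exist _ _ (delta_axiom k).

Definition ss_one : shift_series := shift_elt 0.

Definition ss_mul p q : shift_series := exist _ _ (convol_axiom p q).

Fact ss_mulA : associative ss_mul.
Proof.
move=> p q r; apply: shift_seriesP; last exact: addrA.
rewrite /coef /= -/(coef p) -/(coef q) -/(coef r) /shift_deg /=.
rewrite -/(shift_deg p) -/(shift_deg q).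
rewrite -truncate_translate truncate_convol_right truncate_convol_left.
rewrite translate_convol translateD.
by rewrite convolA.
Qed.

Fact ss_mul1g : left_id ss_one ss_mul.
Proof.
move=> p; apply: shift_seriesP; last exact: add0r.
by rewrite /coef /= translate0 convol_deltal coef_truncate.
Qed.

Fact ss_mulg1 : right_id ss_one ss_mul.
Proof.
move=> p; apply: shift_seriesP; last exact: addr0.
by rewrite {1}/coef /= translate_delta convol_deltar coef_truncate.
Qed.

HB.instance Definition _ := isMonoid.Build shift_series ss_mulA ss_mul1g ss_mulg1.

End GoodWords.

Section ShiftSeriesGroup.
Local Open Scope ring_scope.
Local Notation SS := shift_series.
Implicit Types (p q r : shift_series) (U V W : seq int).

Lemma coef_one : coef (1%g : SS) = @delta int. Proof. by []. Qed.

Lemma coef_mul p q : coef (p * q)%g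
  = truncate (convol (coef p) (translate (shift_deg p) (coef q))).
Proof. by []. Qed.

Lemma shift_degM p q : shift_deg (p * q)%g = shift_deg p + shift_deg q.
Proof. by []. Qed.

Lemma shift_degX p n : shift_deg p = 0 -> shift_deg (p ^+ n)%g = 0.
Proof. by move=> p0; elim: n => [//|n IH]; rewrite expgS shift_degM p0 IH. Qed.

(** For elements of degree 0, the elements agreeing with 1 up to order k form a
    descending central series as k grows. *)
Definition agree k p q : Prop := forall W, (size W <= k)%N -> coef p W = coef q W.

Lemma agree_mul k p p' q q' : shift_deg p = 0 -> shift_deg p' = 0 ->
  agree k p p' -> agree k q q' -> agree k (p * q)%g (p' * q')%g.
Proof.
move=> p0 p'0 pp' qq' W Wk; rewrite !coef_mul p0 p'0 !translate0 /truncate.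
case: ifP => // _; apply: eq_convol => U V UV.
move: Wk; rewrite -UV size_cat => UVk.
by rewrite pp' ?qq' //; apply: leq_trans UVk; rewrite ?leq_addl ?leq_addr.
Qed.

(** Below degree k + 2 only the two extreme factorizations of a word
    contribute. *)
Lemma agree1_mull k p q W : shift_deg p = 0 -> agree k p 1%g ->
  W != [::] -> (size W <= k.+1)%N -> coef (p * q)%g W = coef p W + coef q W.
Proof.
move=> p0 p1; case: W => // x W _ Wk; rewrite coef_mul p0 translate0.
have -> : coef p (x :: W) + coef q (x :: W)
    = truncate (fun V => coef p V + coef q V) (x :: W).
  rewrite -[in LHS](coef_truncate p) -[in LHS](coef_truncate q) /truncate.
  by case: ifP; rewrite ?addr0.
rewrite /truncate; case: ifP => // _ /=; rewrite coef_nil mul1r addrC.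
congr (_ + _); rewrite -[W in LHS]cats0 convol_single ?cats0 ?coef_nil ?mulr1 //.
move=> U V UV sU; rewrite p1 ?mul0r //=.
have := congr1 size UV; rewrite size_cat /= in Wk *; lia.
Qed.

Lemma agree1_mulr k p q W : shift_deg p = 0 -> agree k p 1%g ->
  shift_deg q = 0 -> W != [::] -> (size W <= k.+1)%N ->
  coef (q * p)%g W = coef q W + coef p W.
Proof.
move=> p0 p1 q0; case: W => // x W _ Wk; rewrite coef_mul q0 translate0.
have -> : coef q (x :: W) + coef p (x :: W)
    = truncate (fun V => coef q V + coef p V) (x :: W).
  rewrite -[in LHS](coef_truncate p) -[in LHS](coef_truncate q) /truncate.
  by case: ifP; rewrite ?addr0.
rewrite /truncate; case: ifP => // _ /=; rewrite coef_nil mul1r addrC.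
congr (_ + _); rewrite -[W in LHS]cats0 convol_single ?cats0 ?coef_nil ?mulr1 //.
move=> U V UV sU; rewrite (p1 V) ?coef_one /delta.
  case: V UV => [|? ?] UV; last by rewrite mulr0.
  by case: sU; rewrite -(congr1 size UV) !cats0.
have := congr1 size UV; rewrite size_cat /= in Wk *; lia.
Qed.

(** In degree k + 1 the cube multiplies the coefficient by 3, which vanishes in
    F_3. *)
Lemma agree_cube k p : shift_deg p = 0 -> agree k p 1%g ->
  agree k.+1 (p ^+ 3)%g 1%g.
Proof.
move=> p0 p1 W Wk; have [->|W0] := eqVneq W [::]; first by rewrite !coef_nil.
rewrite !expgS expg0 mulg1 !(agree1_mull _ p0 p1 W0 Wk) coef_one /delta.
case: W W0 {Wk} => // x W _; case: (coef p _) => -[|[|[|//]]] i; exact/eqP.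
Qed.

Lemma local_sep B p q : local B (coef p) -> local B (coef q) ->
  agree (2 * B + 1) p q -> coef p = coef q.
Proof.
move=> pB qB pq; apply/funext => W.
have [W_B|nW] := boolP (all (in_radius B) W); last by rewrite pB ?qB.
have [gW|bW] := boolP (good W); first by apply: pq; exact: good_size.
by rewrite -coef_truncate -[coef q]coef_truncate /truncate (negbTE bW).
Qed.

Lemma local_mul B p q : shift_deg p = 0 -> local B (coef p) ->
  local B (coef q) -> local B (coef (p * q)%g).
Proof.
move=> p0 pB qB; rewrite coef_mul p0 translate0.
by apply: local_truncate; apply: local_convol.
Qed.

Lemma local1 B : local B (coef (1%g : SS)). Proof. by move=> [|x W]. Qed.

Lemma localX B p n : shift_deg p = 0 -> local B (coef p) ->
  local B (coef (p ^+ n)%g).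
Proof.
move=> p0 pB; elim: n => [|n IH]; first exact: local1.
by rewrite expgS; exact: local_mul.
Qed.

(** After 2B + 1 cubings all coefficients of good words over a set of radius B
    have been cleared. *)
Lemma unipotent_odd_order p : shift_deg p = 0 -> exists n, (p ^+ (3 ^ n))%g = 1%g.
Proof.
move=> p0; have [B pB] := coef_local p; exists (2 * B + 1)%N.
apply: shift_seriesP; last exact: shift_degX.
apply: (@local_sep B); [exact: localX | exact: local1 |].
elim: (2 * B + 1)%N => [|k IH]; last first.
  by rewrite expnSr expgnA; apply: agree_cube => //; exact: shift_degX.
by move=> W; rewrite leqn0 => /nilP ->; rewrite !coef_nil.
Qed.

Lemma shift_eltD k l : (shift_elt k * shift_elt l)%g = shift_elt (k + l).
Proof.
apply: shift_seriesP => //; rewrite coef_mul /= {2}/coef /= translate_delta convol_deltar.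
exact: (coef_truncate (shift_elt 0)).
Qed.

Lemma unipotent_shift p : exists2 u : SS, shift_deg u = 0 &
  p = (u * shift_elt (shift_deg p))%g.
Proof.
exists (p * shift_elt (- shift_deg p))%g; first by rewrite shift_degM /= subrr.
by rewrite -mulgA shift_eltD addNr mulg1.
Qed.

(** Inverses are powers on the series side, since these elements have finite
    order, and opposite translations on the other side. *)
Fact shift_series_invertible p : exists q : SS, (q * p = 1 /\ p * q = 1)%g.
Proof.
have [u u0 pE] := unipotent_shift p; set k := shift_deg p in pE.
have [n un] := unipotent_odd_order u0.
have kk l : (shift_elt l * shift_elt (- l) = 1)%g by rewrite shift_eltD subrr.
have uV : (u ^+ (3 ^ n).-1 * u = 1)%g by rewrite -expgSr prednK ?expn_gt0.
have uV' : (u * u ^+ (3 ^ n).-1 = 1)%g by rewrite -expgS prednK ?expn_gt0.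
exists (shift_elt (- k) * u ^+ (3 ^ n).-1)%g; rewrite pE; split.
  rewrite mulgA -(mulgA _ _ u) uV mulg1 shift_eltD addNr; exact: erefl.
by rewrite -mulgA (mulgA (shift_elt k)) kk mul1g.
Qed.

Definition ss_inv p : SS := sval (cid (shift_series_invertible p)).

HB.instance Definition _ := hasInv.Build shift_series ss_inv.

Fact ss_mulVg : left_inverse 1%g (@monoid.inv shift_series) *%g.
Proof. by move=> p; exact: (svalP (cid (shift_series_invertible p))).1. Qed.
Fact ss_mulgV : right_inverse 1%g (@monoid.inv shift_series) *%g.
Proof. by move=> p; exact: (svalP (cid (shift_series_invertible p))).2. Qed.

HB.instance Definition _ := Monoid_isGroup.Build shift_series ss_mulVg ss_mulgV.

Lemma shift_degV p : shift_deg p^-1%g = - shift_deg p.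
Proof.
have : shift_deg (p^-1 * p)%g = 0 by rewrite mulVg.
by rewrite shift_degM => /eqP; rewrite addr_eq0 => /eqP.
Qed.

Lemma agree_central k p q : shift_deg p = 0 -> shift_deg q = 0 ->
  agree k p 1%g -> agree k.+1 (p * q)%g (q * p)%g.
Proof.
move=> p0 q0 p1 W Wk; have [->|W0] := eqVneq W [::]; first by rewrite !coef_nil.
by rewrite (agree1_mull _ p0 p1 W0 Wk) (agree1_mulr p0 p1 q0 W0 Wk) addrC.
Qed.

Definition local_subgroup B : set SS :=
  [set p | shift_deg p = 0 /\ local B (coef p)].

(** An inverse is a power, so it involves no new letters. *)
Lemma is_subgroup_local B : is_subgroup (local_subgroup B).
Proof.
split=> [|p q [p0 pB] [q0 qB]]; first by split; [|exact: local1].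
split; first by rewrite shift_degM shift_degV p0 q0 subrr.
have [n qn] := unipotent_odd_order q0.
have -> : (q^-1 = q ^+ (3 ^ n).-1)%g.
  by apply: mulg1_eq; rewrite -expgS prednK ?expn_gt0.
by apply: local_mul => //; exact: localX.
Qed.

(** * Letters *)

Definition letter_series (c : 'F_3) (z : int) : seq int -> 'F_3 :=
  fun W => delta W + c * (W == [:: z])%:R.

Fact letter_axiom c z : shift_series_axiom (letter_series c z, 0).
Proof.
split=> /=.
- by rewrite /letter_series /delta /= mulr0 addr0.
- apply/funext => W; rewrite /truncate; case: ifP => // /negP bW.
  rewrite /letter_series /delta; case: W bW => [/(_ good_nil)//|x W] bW.
  have [E|_] := eqVneq (x :: W) [:: z]; last by rewrite mulr0 addr0.
  by case: bW; rewrite E; exact: good_seq1.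
exists `|z|%N => -[//|x W] nW; rewrite /letter_series /delta /= add0r.
have [E|_] := eqVneq (x :: W) [:: z]; last by rewrite mulr0.
by move: nW; rewrite E /= /in_radius leqnn.
Qed.

Definition letter c z : SS := exist _ _ (letter_axiom c z).

Lemma convol_letter c z f W : convol (letter_series c z) f W
  = f W + (if W is x :: W' then if x == z then c * f W' else 0 else 0).
Proof.
case: W => [|x W] /=.
  by rewrite /letter_series /delta /= mulr0 !addr0 mul1r.
rewrite {1}/letter_series {1}/delta /= mulr0 addr0 mul1r; congr (_ + _).
have -> : (fun V => letter_series c z (x :: V))
    = (fun V => (c * (x == z)%:R) * delta V).
  apply/funext => V; rewrite /letter_series /delta /= add0r eqseq_cons.
  by case: (x == z); case: V => [|? ?]; rewrite /= ?mulr1 ?mulr0 ?mul0r.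
rewrite convolZl convol_deltal; case: (x == z); first by rewrite mulr1.
by rewrite mulr0 mul0r.
Qed.

Lemma letterV z : (letter 1%R z)^-1%g = letter (-1) z.
Proof.
apply: mulg1_eq; apply: shift_seriesP => //; rewrite coef_mul translate0 coef_one.
apply/funext => W; rewrite /truncate; case: ifP => [gW|/negP bW]; last first.
  by case: W bW => // /(_ good_nil).
rewrite convol_letter -[coef (letter _ _)]/(letter_series (-1) z).
have ls0 : letter_series (-1) z [::] = 1.
  by rewrite /letter_series /delta /= mulr0 addr0.
have ls1 x : letter_series (-1) z [:: x] = - (x == z)%:R.
  by rewrite /letter_series /delta /= add0r eqseq_cons andbT mulN1r.
have ls2 x y V : letter_series (-1) z [:: x, y & V] = 0.
  by rewrite /letter_series /delta /= add0r eqseq_cons andbF mulr0.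
case: W gW => [|x [|y W]] gW; first by rewrite ls0 addr0.
  by rewrite ls1 ls0; case: (x == z); apply/eqP.
rewrite ls2 add0r mul1r; have [xz|//] := eqVneq x z.
case: W gW => [|w W] gW; last by rewrite ls2.
rewrite ls1; have [yz|_] := eqVneq y z; last by rewrite oppr0.
by move: gW; rewrite xz yz (negbTE (good_double _ _)).
Qed.

Lemma letter_shift z : letter 1 z = (letter 1%R 0%R ^ (shift_elt z)^-1)%g.
Proof.
have zV : (shift_elt z)^-1%g = shift_elt (- z).
  by apply: mulg1_eq; rewrite shift_eltD subrr.
rewrite /conjg invgK zV mulgA; apply: shift_seriesP; last first.
  by rewrite !shift_degM /= /shift_deg /= addr0 subrr.
rewrite coef_mul translate_delta convol_deltar coef_truncate.
rewrite coef_mul convol_deltal truncate_translate coef_truncate.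
apply/funext => W; rewrite /translate /coef /= /letter_series; congr (_ + _ * _).
  by case: W.
by case: W => [|x [|y W]] //=; rewrite !eqseq_cons ?andbF // !andbT subr_eq0.
Qed.

End ShiftSeriesGroup.

Arguments letter (c z)%_R.

(** * Mixed words evaluated at far apart letters *)

Definition starts_in (Y : pred int) (W : seq int) : bool :=
  if W is z :: _ then Y z else true.

Section TopDegree.
Local Open Scope ring_scope.
Variable Y : pred int.
Implicit Types (f u : seq int -> 'F_3) (U V W : seq int).

Definition deg_le m f : Prop := forall W, (m < count Y W)%N -> f W = 0.

(** Y singles out the far letters. At the top count m a nonzero coefficient
    forces the word to begin with a far letter; this keeps a coefficient of the
    mixed word from absorbing part of the next block. *)
Definition top_at m f : Prop :=
  deg_le m f /\ forall z W, ~~ Y z -> count Y W = m -> f (z :: W) = 0.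

Lemma deg_le_convol m n u f : deg_le m u -> deg_le n f ->
  deg_le (m + n) (truncate (convol u f)).
Proof.
move=> um fn W Wmn; rewrite /truncate; case: ifP => // _.
apply: convol_eq0 => U V UV; move: Wmn; rewrite -UV count_cat => Wmn.
have [mU|Um] := ltnP m (count Y U); first by rewrite um ?mul0r.
by rewrite fn ?mulr0 //; lia.
Qed.

Lemma top_at_letter m c z f : Y z -> deg_le m f ->
  top_at m.+1 (truncate (convol (letter_series c z) f)).
Proof.
move=> Yz fm; split=> [W mW|x W nYx Wm]; rewrite /truncate; case: ifP => // _;
    rewrite convol_letter.
  case: W mW => [|x W] //= mW; rewrite fm ?add0r; last by rewrite /=; lia.
  case: eqP => // xz; rewrite fm ?mulr0 //.
  by move: mW; rewrite xz Yz; lia.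
rewrite fm; last by rewrite /= Wm (negbTE nYx); lia.
by rewrite add0r; case: eqP => // xz; rewrite xz Yz in nYx.
Qed.

(** The word z :: W contains one far letter too many for f, so only the factor
    z contributes. *)
Lemma letter_lead m c z f W : Y z -> deg_le m f -> count Y W = m ->
  good (z :: W) -> truncate (convol (letter_series c z) f) (z :: W) = c * f W.
Proof.
move=> Yz fm Wm gW; rewrite /truncate gW convol_letter eqxx fm ?add0r //=.
by rewrite Yz Wm; lia.
Qed.

(** The left factor has no far letter, so it cannot reach into W; if it stopped
    before the end of V, the remaining word would start with a near letter
    while carrying all far letters, which top_at forbids. *)
Lemma const_lead m u f V W : deg_le 0 u -> top_at m f -> ~~ has Y V ->
  count Y W = m -> starts_in Y W -> good (V ++ W) ->
  truncate (convol u f) (V ++ W) = u V * f W.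
Proof.
move=> u0 [fm ftop] nV Wm Wh gVW; rewrite /truncate gVW.
apply: convol_single => U' V' UV sU.
have [lt_VU|le_UV] := ltnP (size V) (size U').
  rewrite u0 ?mul0r // -has_count; have := congr1 (take (size U')) UV.
  rewrite take_size_cat // => ->; rewrite take_cat ltnNge (ltnW lt_VU) /=.
  rewrite has_cat; case: W Wh {Wm gVW} UV => [_ UV|z W /= Yz UV].
    by have := congr1 size UV; rewrite !size_cat /=; lia.
  by rewrite -[(size U' - _)%N]prednK /= ?Yz ?orbT // subn_gt0.
have := congr1 (drop (size U')) UV; rewrite drop_size_cat // => ->.
rewrite drop_cat; have lt_UV : (size U' < size V)%N.
  by rewrite ltn_neqAle le_UV andbT; apply/eqP.
rewrite lt_UV.
case E : (drop (size U') V) => [|z V2].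
  by have := congr1 size E; rewrite size_drop /=; lia.
have nzV2 : ~~ has Y (z :: V2).
  rewrite -E; apply: contra nV => hasV.
  by rewrite -(cat_take_drop (size U') V) has_cat hasV orbT.
rewrite /= ftop ?mulr0 //; first by move: nzV2; rewrite /= negb_or => /andP[].
rewrite count_cat Wm; move: nzV2; rewrite /= negb_or => /andP[_].
by rewrite has_count -eqn0Ngt => /eqP ->.
Qed.

End TopDegree.

Section FarWords.
Local Open Scope ring_scope.
Implicit Types (U V W b : seq int).

Lemma spread_far T z h b : z \in b -> h \in b -> (size b <= T)%N ->
  (T <= `|z - h| + 1)%N -> spread b.
Proof.
move=> zb hb bT zh; have [le_zh|lt_hz] := leP z h.
  by apply/hasP; exists z => //; apply/hasP; exists h => //; lia.
by apply/hasP; exists h => //; apply/hasP; exists z => //; lia.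
Qed.

Lemma good_cons z W : good W ->
  (forall b V, W = b ++ V -> spread (z :: b)) -> good (z :: W).
Proof.
move=> /asboolP gW pre; apply/asboolP => -[|x U] b V.
  by case: b => [|y b] // [<- WE] _; exact: (pre b V WE).
by case=> _ WE; exact: (gW U b V WE).
Qed.

Lemma good_prefix z b V : good (z :: b ++ V) -> spread (z :: b).
Proof. by move=> /asboolP /(_ [::] (z :: b) V erefl isT). Qed.

(** A factor across the junction contains a letter of V and the first letter of
    W, and these are far apart. *)
Lemma good_cat_far T V W : good V -> good W -> (size (V ++ W) <= T)%N ->
  (if W is h :: _ then {in V, forall z, (T <= `|z - h| + 1)%N} else True) ->
  good (V ++ W).
Proof.
move=> + gW; elim: V => [|z V IH] //= gzV szT far.
have gV : good V by move: gzV; rewrite -cat1s => /good_catr.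
apply: good_cons => [|b b' E].
  apply: IH => //; first exact: ltnW.
  by case: (W) far => // h ? far x xV; apply: far; rewrite inE xV orbT.
have [bV|Vb] := leqP (size b) (size V).
  have bE : b = take (size b) V.
    by have := congr1 (take (size b)) E; rewrite [RHS]take_size_cat // takel_cat.
  apply: (good_prefix (V := drop (size b) V)).
  by rewrite {1}bE cat_take_drop.
case: W gW E far szT {IH} => [|h W] gW E far szT.
  by have := congr1 size E; rewrite !size_cat /=; lia.
have hb : h \in b.
  have := congr1 (take (size b)) E; rewrite [RHS]take_size_cat // => <-.
  rewrite take_cat ltnNge (ltnW Vb) /= mem_cat.
  by rewrite -[(size b - _)%N]prednK ?subn_gt0 //= inE eqxx orbT.
apply: (@spread_far T z h); rewrite ?inE ?eqxx ?hb ?orbT //.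
  by have := congr1 size E; rewrite !size_cat /= in szT *; lia.
by apply: far; rewrite inE eqxx.
Qed.

End FarWords.

Section MixedCoefficient.
Local Open Scope ring_scope.
Variables (n : nat) (gap : nat) (v : shift_series -> seq int).
Hypothesis v_coef : forall g, coef g (v g) != 0.
Hypothesis v_nil : forall g, v g = [::] -> coef g = @delta int.
Local Notation item := ('I_n * bool * shift_series)%type.
Implicit Types (s : seq item) (o : int) (W : seq int).

(** The center of the c-th cluster of far letters. Clusters stay apart from
    each other, and from the letters of the coefficients, under all
    translations that occur in the mixed word. *)
Definition pos (c : nat) : int := (c.+1 * gap)%N%:Z.

(** The variable X_i is replaced by the product of two letters, from the
    clusters 2i and 2i + 1. Its inverse lists them in the opposite order, so e
    selects which cluster comes first. *)
Definition fst_class (i : 'I_n) (e : bool) : nat := (2 * i + ~~ e)%N.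
Definition snd_class (i : 'I_n) (e : bool) : nat := (2 * i + e)%N.

Definition far_elt (i : 'I_n) : shift_series :=
  (letter 1 (pos (fst_class i true)) * letter 1 (pos (snd_class i true)))%g.

Definition sign (e : bool) : 'F_3 := if e then 1 else -1.

Lemma far_eltE i e : (if e then far_elt i else (far_elt i)^-1)%g
  = (letter (sign e) (pos (fst_class i e)) * letter (sign e) (pos (snd_class i e)))%g.
Proof. by case: e => //; rewrite /far_elt invgM !letterV. Qed.

(** Each block carries the two letters of a variable and a word v g occurring
    in the next coefficient; o is the accumulated translation. *)
Fixpoint lead_word s o : seq int :=
  if s is (i, e, g) :: s' then
    pos (fst_class i e) + o :: pos (snd_class i e) + o ::
      shift_word o (v g) ++ lead_word s' (o + shift_deg g)
  else [::].

Definition total_deg s : nat := sumn [seq `|shift_deg l.2|%N | l <- s].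

Definition lead_size s : nat := sumn [seq (2 + size (v l.2))%N | l <- s].

Lemma size_lead_word s o : size (lead_word s o) = lead_size s.
Proof.
elim: s o => [|[[i e] g] s IH] o //=.
by rewrite size_cat size_map IH /lead_size /=; lia.
Qed.

Variables (B D T : nat).
Definition bounded s o : Prop :=
  [/\ (`|o| + total_deg s <= D)%N, (lead_size s <= T)%N &
      forall l, l \in s -> local B (coef l.2)].

Lemma bounded_cons i e g s o : bounded ((i, e, g) :: s) o ->
  [/\ (`|o| <= D)%N, local B (coef g) & bounded s (o + shift_deg g)].
Proof.
move=> [oD szT sB]; rewrite /total_deg /lead_size /= in oD szT.
split; [by lia | exact: (sB (i, e, g)) (mem_head _ _) |].
split; rewrite /total_deg /lead_size; [by lia | by lia |].
by move=> l ls; apply: sB; rewrite inE ls orbT.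
Qed.

Lemma v_bounded g o z : local B (coef g) -> (`|o| <= D)%N ->
  z \in shift_word o (v g) -> (`|z| <= B + D)%N.
Proof.
move=> gB oD /mapP[x xv ->].
have /allP/(_ _ xv) : all (in_radius B) (v g).
  by apply: contraNT (v_coef g) => /gB ->.
by rewrite /in_radius; lia.
Qed.

Let Y : pred int := fun z => (B + D < `|z|)%N.

Lemma deg_le_translate g o : local B (coef g) -> (`|o| <= D)%N ->
  deg_le Y 0 (translate o (coef g)).
Proof.
move=> gB oD W; rewrite -has_count => /hasP[z zW Yz]; apply: gB.
apply/negP => /allP /(_ (z - o)); rewrite /in_radius => zo.
have : (`|z - o| <= B)%N.
  by apply: zo; apply/mapP; exists z.
by move: Yz; rewrite /Y; lia.
Qed.

Hypothesis gapE : gap = (2 * B + 4 * D + T + 1)%N.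

Lemma pos_far c o z : (`|o| <= D)%N -> (`|z| <= B + D)%N ->
  (T <= `|(pos c + o)%R - z| + 1)%N /\ (T <= `|z - (pos c + o)%R| + 1)%N.
Proof.
move=> oD zB; have : (gap <= c.+1 * gap)%N by rewrite mulSn leq_addr.
by rewrite /pos; lia.
Qed.

Lemma pos_pos_far c c' o o' : (`|o| <= D)%N -> (`|o'| <= D)%N -> c <> c' ->
  (T <= `|(pos c + o)%R - (pos c' + o')%R| + 1)%N.
Proof.
move=> oD oD' cc; have [lt_cc|lt_cc|//] := ltngtP c c'.
  have : (c.+1 * gap + gap <= c'.+1 * gap)%N by rewrite -mulSnr leq_mul2r ltnS lt_cc orbT.
  by rewrite /pos; lia.
have : (c'.+1 * gap + gap <= c.+1 * gap)%N by rewrite -mulSnr leq_mul2r ltnS lt_cc orbT.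
by rewrite /pos; lia.
Qed.

Lemma good_v g o : good (shift_word o (v g)).
Proof. by rewrite good_shift; exact: coef_good (v_coef g). Qed.

(** A factor with two letters from different clusters, or with a far and a near
    letter, has enough spread. The remaining factors lie in some v g or consist
    of far letters of a single cluster. In the latter case there are at most
    two, from adjacent blocks, and this requires X_i^e followed by X_i^-e with
    an empty v g; reducedness then makes the coefficient a nontrivial
    translation, so that the two letters differ. *)
Lemma good_lead_word s o : reduced s -> bounded s o -> good (lead_word s o).
Proof.
elim: s o => [|[[i e] g] s IH] o; first by rewrite good_nil.
move=> /= /andP[red_s nc] bs; have [_ szT _] := bs.
have [oD gB bs'] := bounded_cons bs.
have gW := IH _ red_s bs'.
set y1 := pos (fst_class i e) + o; set y2 := pos (snd_class i e) + o.
set W := lead_word s _ in gW *.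
have szW : (size (y1 :: y2 :: shift_word o (v g) ++ W) <= T)%N.
  by rewrite -[_ :: _]/(lead_word ((i, e, g) :: s) o) size_lead_word.
have fst_snd : fst_class i e <> snd_class i e.
  by rewrite /fst_class /snd_class; case: (e); lia.
have gvW : good (shift_word o (v g) ++ W).
  apply: (@good_cat_far T) => //; [exact: good_v|by move: szW => /=; lia|].
  rewrite /W; case: (s) bs' => [|[[j e'] h] s'] //= bs' z zv.
  have [oD' _ _] := bounded_cons bs'.
  by apply: (pos_far _ oD' _).2; exact: v_bounded zv.
apply: good_cons => [|b V E]; last first.
  case: b E => [|y b] E; first exact: spread_seq1.
  apply: (@spread_far T y1 y2); rewrite ?inE ?eqxx //.
  - by case: E => <- _; rewrite eqxx orbT.
  - by have := congr1 size E; move: szW; rewrite /= !size_cat /= ?size_cat; lia.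
  by apply: pos_pos_far.
apply: good_cons => // b V; case: b => [|z b]; first by rewrite spread_seq1.
case Ev : (shift_word o (v g)) => [|x v'].
  rewrite /W in szW *.
  case: (s) nc bs' szW => [|[[j e'] h] s'] //= nc bs' szW [zE E].
  have [oD' _ _] := bounded_cons bs'.
  set y3 := pos _ + _ in zE; rewrite -zE {z zE}.
  case: b E => [|z b] E; last first.
    have fst_snd' : fst_class j e' <> snd_class j e'.
      by rewrite /fst_class /snd_class; case: (e'); lia.
    case: E => <- E; set y4 := pos _ + _.
    apply: (@spread_far T y3 y4); rewrite ?inE ?eqxx ?orbT //.
      have := congr1 size E; move: szW; rewrite /= !size_cat /= !size_cat size_map.
      by lia.
    exact: pos_pos_far.
  have [ce|ce] := eqVneq (snd_class i e) (fst_class j e'); last first.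
    apply: (@spread_far T y2 y3); rewrite ?inE ?eqxx ?orbT //.
      by move: szW => /=; lia.
    by apply: pos_pos_far => //; apply/eqP.
  have [ij ee'] : j = i /\ e' = ~~ e.
    move: ce; rewrite /snd_class /fst_class => ce.
    have ee' : e' = ~~ e by case: (e) (e') ce => [] []; lia.
    by split=> //; apply/val_inj; move: ce; rewrite /= ee' negbK; lia.
  have v0 : v g = [::] by case: (v g) Ev.
  have g1 : g <> 1%g.
    by move=> g1; move: nc; rewrite g1 ij ee' !eqxx.
  have g2 : shift_deg g <> 0.
    by move=> g2; apply: g1; apply: shift_seriesP => //; rewrite v_nil.
  apply: (@spread_far 2 y2 y3); rewrite ?inE ?eqxx ?orbT //.
  by rewrite /y2 /y3 -ce; lia.
move=> [zE E]; apply: (@spread_far T y2 z); rewrite ?inE ?eqxx ?orbT //.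
  by have := congr1 size E; move: szW; rewrite Ev /= !size_cat /=; lia.
apply: (pos_far _ oD _).1; apply: (@v_bounded g o) => //.
by rewrite Ev zE mem_head.
Qed.

Lemma translate_coefM o (p q : shift_series) : translate o (coef (p * q)%g)
  = truncate (convol (translate o (coef p)) (translate (o + shift_deg p) (coef q))).
Proof. by rewrite coef_mul -truncate_translate translate_convol translateD. Qed.

Lemma translate_letter o c z :
  translate o (coef (letter c z)) = letter_series c (z + o).
Proof.
apply/funext => W; rewrite /translate /coef /= /letter_series; congr (_ + _ * _).
  by case: W.
by case: W => [|x [|y W]] //=; rewrite !eqseq_cons ?andbF // !andbT subr_eq.
Qed.

Lemma pos_Y c o : (`|o| <= D)%N -> Y (pos c + o).
Proof.
move=> oD; have : (gap <= c.+1 * gap)%N by rewrite mulSn leq_addr.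
by rewrite /Y /pos; lia.
Qed.

Lemma const_times_lead g o m f W : local B (coef g) -> (`|o| <= D)%N ->
  top_at Y m f -> count Y W = m -> starts_in Y W ->
  f W != 0 -> good (shift_word o (v g) ++ W) ->
  deg_le Y m (truncate (convol (translate o (coef g)) f)) /\
  truncate (convol (translate o (coef g)) f) (shift_word o (v g) ++ W) != 0.
Proof.
move=> gB oD ftop Wm Wh fW gW; have g0 := deg_le_translate gB oD.
split; first by apply: (deg_le_convol g0); case: ftop.
rewrite (const_lead g0 ftop) //; last first.
  apply/hasPn => z zv; rewrite /Y -leqNgt; exact: v_bounded zv.
by rewrite mulf_neq0 // /translate shift_wordK v_coef.
Qed.

Lemma sign_neq0 e : sign e != 0. Proof. by case: e. Qed.

(** Reading the word from right to left, each block multiplies the coefficient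
    of the leading word by a nonzero scalar and raises the number of far
    letters by two. *)
Lemma mixed_lead_coef s o : bounded s o -> good (lead_word s o) ->
  [/\ top_at Y (2 * size s) (translate o (coef (mixed_eval id far_elt s))),
      count Y (lead_word s o) = (2 * size s)%N &
      translate o (coef (mixed_eval id far_elt s)) (lead_word s o) != 0].
Proof.
elim: s o => [|[[i e] g] s IH] o bs gW.
  rewrite /= coef_one translate_delta; split=> //.
  by split=> // -[].
have [oD gB bs'] := bounded_cons bs.
have gW2 : good (pos (snd_class i e) + o :: shift_word o (v g)
    ++ lead_word s (o + shift_deg g)).
  by move: gW; rewrite /= -cat1s => /good_catr.
have gW1 : good (shift_word o (v g) ++ lead_word s (o + shift_deg g)).
  by move: gW2; rewrite /= -cat1s => /good_catr.
have [ftop Wm fW] := IH _ bs' (good_catr gW1).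
have Wh : starts_in Y (lead_word s (o + shift_deg g)).
  case: (s) bs' => [|[[j e'] h] s'] // /bounded_cons[oD' _ _] /=.
  exact: pos_Y.
have [f1 f1W] := const_times_lead gB oD ftop Wm Wh fW gW1.
rewrite -translate_coefM in f1 f1W.
set x := (g * mixed_eval id far_elt s)%g in f1 f1W.
have W1m : count Y (shift_word o (v g) ++ lead_word s (o + shift_deg g))
    = (2 * size s)%N.
  rewrite count_cat Wm; suff /eqP -> : count Y (shift_word o (v g)) == 0%N by [].
  rewrite eqn0Ngt -has_count; apply/hasPn => z zv; rewrite /Y -leqNgt.
  exact: v_bounded zv.
set W1 := (_ ++ _) in gW1 gW2 f1W W1m.
have Y1 := pos_Y (fst_class i e) oD; have Y2 := pos_Y (snd_class i e) oD.
have f2 := top_at_letter (sign e) Y2 f1.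
have f2W := letter_lead (sign e) Y2 f1 W1m gW2.
have W2m : count Y (pos (snd_class i e) + o :: W1) = (2 * size s).+1.
  by rewrite /= Y2 W1m.
have f3 := top_at_letter (sign e) Y1 f2.1.
have f3W := letter_lead (sign e) Y1 f2.1 W2m gW.
have -> : translate o (coef (mixed_eval id far_elt ((i, e, g) :: s)))
    = truncate (convol (letter_series (sign e) (pos (fst_class i e) + o))
        (truncate (convol (letter_series (sign e) (pos (snd_class i e) + o))
          (translate o (coef x))))).
  rewrite [mixed_eval _ _ _]/= far_eltE -mulgA -!translate_letter.
  rewrite translate_coefM addr0; congr (truncate (convol _ _)).
  by rewrite translate_coefM addr0.
have -> : (2 * size ((i, e, g) :: s) = (2 * size s).+2)%N by rewrite /=; lia.
split=> //; first by rewrite /= Y1 Y2 W1m.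
by rewrite f3W f2W !mulf_neq0 ?sign_neq0.
Qed.

End MixedCoefficient.

Lemma far_evaluation_neq1 n (g : shift_series) (s : seq ('I_n * bool * shift_series)) :
  reduced s -> s != [::] ->
  exists gap : nat, (g * mixed_eval id (far_elt gap) s)%g != 1%g.
Proof.
move=> red_s s0.
have /choice[v vP] : forall p, exists V : seq int, coef p V != 0%R /\
    (V = [::] -> coef p = @delta int).
  move=> p; have [[x [V pV]]|p1] :=
      pselect (exists x V, coef p (x :: V) != 0%R); first by exists (x :: V).
  exists [::]; rewrite coef_nil; split=> // _; apply/funext => -[|x V].
    by rewrite coef_nil.
  by apply/eqP/negPn/negP => pV; apply: p1; exists x, V.
have v_coef p := (vP p).1; have v_nil p := (vP p).2.
have /choice[Bl BlP] := coef_local.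
pose B := (Bl g + \max_(l <- s) Bl l.2)%N.
pose D := (`|shift_deg g| + total_deg s)%N.
pose T := lead_size v s.
(* B bounds the letters of the coefficients, D the accumulated translations,
   and T the length of the leading word, that is, the spread to be guaranteed.
   *)
pose gap := (2 * B + 4 * D + T + 1)%N; exists gap.
have bs : bounded v B D T s (shift_deg g).
  split=> // l ls; apply: (local_mono _ (BlP l.2)).
  apply: leq_trans (leq_addl _ _).
  exact: (@leq_bigmax_seq _ _ _ (fun l => Bl l.2)).
have gW := good_lead_word v_coef v_nil (erefl gap) red_s bs.
have [ftop Wm fW] := mixed_lead_coef v_coef (erefl gap) bs gW.
set W := lead_word _ _ _ _ in gW Wm fW.
have W0 : W != [::] by rewrite /W; case: (s) s0 => // -[[i e] h] s'.
suff gfW : coef (g * mixed_eval id (far_elt gap) s)%g W != 0%R.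
  apply: contraNneq gfW => ->; rewrite coef_one /delta.
  by case: (W) W0.
rewrite coef_mul -[coef g]translate0 -[W]cat0s.
set Y := fun z : int => _ in ftop Wm.
rewrite (const_lead (Y := Y) (m := (2 * size s)%N)) //.
- by rewrite translate0 coef_nil mul1r.
- apply: (deg_le_translate (B := B)); last by rewrite /D.
  by apply: (local_mono _ (BlP g)); rewrite /B leq_addr.
rewrite /W; case: (s) bs => [|[[j e'] h] s'] // /bounded_cons[oD' _ _] /=.
exact: (pos_Y (erefl gap)).
Qed.

(** * Finitely generated subgroups *)

Section GeneratedGroup.
Variables (H : groupType) (s : seq H).
Let sS : is_subgroup (generated [set` s]) := generated_subgroup _.

(** The subgroup as a type of its own: finite generation concerns the whole of
    a group. *)
Definition generated_group := {x : H | generated [set` s] x}.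
HB.instance Definition _ := gen_eqMixin generated_group.
HB.instance Definition _ := gen_choiceMixin generated_group.

Implicit Types x y : generated_group.

Lemma generated_groupP x y : sval x = sval y -> x = y.
Proof. by case: x y => [x xP] [y yP] /= xy; apply: eq_exist. Qed.

Definition gg_one : generated_group := exist _ 1 (subgroup1 sS).
Definition gg_mul x y : generated_group :=
  exist _ (sval x * sval y) (subgroupM sS (svalP x) (svalP y)).
Definition gg_inv x : generated_group :=
  exist _ (sval x)^-1 (subgroupV sS (svalP x)).

Fact gg_mulA : associative gg_mul.
Proof. by move=> x y z; apply: generated_groupP; exact: mulgA. Qed.
Fact gg_mul1g : left_id gg_one gg_mul.
Proof. by move=> x; apply: generated_groupP; exact: mul1g. Qed.
Fact gg_mulg1 : right_id gg_one gg_mul.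
Proof. by move=> x; apply: generated_groupP; exact: mulg1. Qed.
Fact gg_mulVg : left_inverse gg_one gg_inv gg_mul.
Proof. by move=> x; apply: generated_groupP; exact: mulVg. Qed.
Fact gg_mulgV : right_inverse gg_one gg_inv gg_mul.
Proof. by move=> x; apply: generated_groupP; exact: mulgV. Qed.

HB.instance Definition _ := isGroup.Build generated_group
  gg_mulA gg_mul1g gg_mulg1 gg_mulVg gg_mulgV.

Definition gg_val x : H := sval x.

Fact gg_valF : {morph gg_val : x y / x / y}. Proof. by []. Qed.

HB.instance Definition _ :=
  isGroupMorphism.Build generated_group H gg_val gg_valF.

Lemma generated_group_fg : finitely_generated generated_group.
Proof.
pose r (h : H) : generated_group := match pselect (generated [set` s] h) with
  | left hP => exist _ h hP | right _ => 1 end.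
exists (map r s); apply/seteqP; split=> // x _.
have : [set h | exists2 y, gg_val y = h & generated [set` map r s] y] (gg_val x).
  apply: (generated_min _ _ (svalP x)).
    split; first by exists 1 => //; exact: (subgroup1 (generated_subgroup _)).
    move=> _ _ [y <- yS] [z <- zS]; exists (y / z) => //.
    exact: (generated_subgroup _).2.
  move=> h hs; exists (r h); last by apply: sub_generated; exact: map_f.
  by rewrite /r; case: pselect => // -[]; exact: sub_generated.
by move=> [y /generated_groupP -> ].
Qed.

End GeneratedGroup.

(** * Transitivity degree one *)

(** A pair of distinct points is completed to a k-tuple by moving a given
    k-tuple of distinct points with two transpositions. *)
Lemma k_transitive_two (G : groupType) (T : Type) (act : G -> T -> T) k :
  (1 < k)%N -> k_transitive k act ->
  forall x y x' y', x <> y -> x' <> y' -> exists g, act g x = x' /\ act g y = y'.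
Proof.
case: k => [|[|k]] // _ [cardT trans].
pose swap (u v z : T) := if `[< z = u >] then v else if `[< z = v >] then u else z.
have swapl u v : swap u v u = v by rewrite /swap; case: asboolP.
have swapr u v : swap u v v = u.
  by rewrite /swap; case: asboolP => // _; case: asboolP.
have swap_id u v z : z <> u -> z <> v -> swap u v z = z.
  by move=> zu zv; rewrite /swap; case: asboolP => // _; case: asboolP.
have swapK u v : involutive (swap u v).
  move=> z; have [->|zu] := pselect (z = u); first by rewrite swapl swapr.
  have [->|zv] := pselect (z = v); first by rewrite swapr swapl.
  by rewrite !swap_id.
pose i0 : 'I_k.+2 := ord0; pose i1 : 'I_k.+2 := lift ord0 ord0.
have [a a_inj] : exists a : 'I_k.+2 -> T, injective a.
  have [f] := card_leP cardT.
  exists (fun i => val (f (to_setT i))) => i j /val_inj fij.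
  by have /(congr1 val) := inj (in_setT (to_setT i)) (in_setT (to_setT j)) fij.
have extend x y : x <> y -> exists b : 'I_k.+2 -> T,
    [/\ injective b, b i0 = x & b i1 = y].
  move=> xy; pose b := swap (a i0) x \o a.
  have b_inj : injective b by apply: inj_comp => //; exact: inv_inj.
  have b0 : b i0 = x by exact: swapl.
  exists (swap (b i1) y \o b); split; first by apply: inj_comp => //; exact: inv_inj.
    by rewrite /= b0 swap_id // -b0 => /b_inj.
  exact: swapl.
move=> x y x' y' xy xy'.
have [b [b_inj <- <-]] := extend _ _ xy; have [b' [b'_inj <- <-]] := extend _ _ xy'.
by have [g gb] := trans b b' b_inj b'_inj; exists g.
Qed.

Lemma regular_action_transitive (G : groupType) : has_faithful_k_transitive_action G 1.
Proof.
exists G, (fun g x => g * x); split.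
- by split=> [x|g h x]; rewrite ?mul1g ?mulgA.
- by move=> g /(_ 1); rewrite mulg1.
split.
  apply: card_le_trans (subset_card_le (subsetT [set (1 : G) | i in [set: 'I_1]])).
  rewrite (card_le_eqr (inj_card_eq _)) // => i j _ _ _.
  by rewrite !ord1.
by move=> a b _ _; exists (b ord0 / a ord0) => i; rewrite (ord1 i) /= mulgVK.
Qed.

Lemma transitivity_degree_one (R : realType) (G : groupType) :
  (forall (T : Type) (act : G -> T -> T), is_group_action act ->
     faithful_action act ->
     ~ forall x y x' y', x <> y -> x' <> y' -> exists g, act g x = x' /\ act g y = y') ->
  transitivity_degree R G = 1%:E%E.
Proof.
move=> not2; apply/eqP; rewrite eq_le; apply/andP; split.
  apply: ge_ereal_sup => _ [k /= [T [act [actG faith transk]]] <-].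
  rewrite lee_fin (ler_nat _ k 1) leqNgt; apply/negP => k1.
  exact: (not2 T act actG faith (k_transitive_two k1 transk)).
apply: ereal_sup_ubound; exists 1%N => //; exact: regular_action_transitive.
Qed.

Section TheExample.

Definition shift_group : groupType :=
  generated_group [:: letter 1%R 0%R; shift_elt 1%R].

Local Notation gens := [set` [:: letter 1%R 0%R; shift_elt 1%R]].

Lemma generated_shift_elt (z : int) : generated gens (shift_elt z).
Proof.
have sG := generated_subgroup gens.
have nat_shift (n : nat) : generated gens (shift_elt n%:Z).
  elim: n => [|n IH]; first exact: (subgroup1 sG).
  have -> : shift_elt n.+1%:Z = shift_elt 1%R * shift_elt n%:Z.
    by rewrite shift_eltD -addn1 PoszD addrC.
  by apply: (subgroupM sG) => //; apply: sub_generated; rewrite /= !inE eqxx orbT.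
case: z => n; first exact: nat_shift.
have -> : shift_elt (Negz n) = (shift_elt n.+1%:Z)^-1.
  by symmetry; apply: mulg1_eq; rewrite shift_eltD NegzE subrr.
exact: (subgroupV sG).
Qed.

Lemma generated_letter (z : int) : generated gens (letter 1%R z).
Proof.
have sG := generated_subgroup gens; have gz := generated_shift_elt z.
rewrite (letter_shift z) /conjg invgK; apply: (subgroupM sG) => //.
apply: (subgroupM sG); last exact: (subgroupV sG).
by apply: sub_generated; rewrite /= !inE eqxx.
Qed.

Lemma shift_group_mixed_identity_free : mixed_identity_free shift_group.
Proof.
apply: mixed_identity_free_reduced => n g s red_s s0.
pose s' := [seq (l.1, sval l.2 : shift_series) | l <- s].
have red_s' : reduced s'.
  rewrite /s'; elim: s red_s {s0 s'} => [|[[i e] h] s IH] //= /andP[/IH -> nc] /=.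
  have -> : (sval h == 1) = (h == 1).
    by apply/eqP/eqP => [h1|->//]; exact: generated_groupP.
  by case: s nc {IH} => [|[[j e'] h'] s].
have [|gap neq1] := far_evaluation_neq1 (sval g) red_s'.
  by rewrite /s'; case: (s) s0.
have far_gen i : generated gens (far_elt (n := n) gap i).
  by apply: (subgroupM (generated_subgroup gens)); exact: generated_letter.
pose sigma i : shift_group := exist _ (far_elt gap i) (far_gen i).
exists sigma; apply: contraNneq neq1 => gs1.
have -> : mixed_eval id (far_elt gap) s' = sval (mixed_eval id sigma s).
  rewrite /s'; elim: (s) => [|[[i e] h] s1 IH] //=.
  by rewrite IH; case: e.
by rewrite -[_ * _]/(sval (g * mixed_eval id sigma s)) gs1.
Qed.

Lemma shift_group_not_two_transitive (T : Type) (act : shift_group -> T -> T) :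
  is_group_action act -> faithful_action act ->
  ~ forall x y x' y', x <> y -> x' <> y' -> exists g, act g x = x' /\ act g y = y'.
Proof.
pose tau (x : shift_group) := shift_deg (sval x).
pose E k (x y : shift_group) := agree k (sval x) (sval y).
pose L B : set shift_group := [set x | local_subgroup B (sval x)].
pose n0 : shift_group := exist _ _ (generated_letter 0%R).
apply: (@not_two_transitive _ tau _ E L _ _ _ _ _ _ _ _ _ _ _ n0) => //.
- by move=> k g h gh W Wk; rewrite gh.
- by move=> k g h l gh hl W Wk; rewrite gh ?hl.
- by move=> g h _ _ W; rewrite leqn0 => /nilP ->; rewrite !coef_nil.
- by move=> k g g' h h' g0 g'0 _ _; exact: agree_mul.
- by move=> k g h; exact: agree_central.
- by move=> k g; exact: agree_cube.
- move=> B; have sB := is_subgroup_local B; split; first exact: (subgroup1 sB).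
  by move=> x y; exact: sB.2.
- by move=> B B' BB' g [g0 gB]; split=> //; exact: local_mono gB.
- move=> g; split=> [g0|[B []]//].
  by have [B gB] := coef_local (sval g); exists B.
- move=> B; exists (2 * B + 1)%N => g h [g0 gB] [h0 hB] gh.
  apply: generated_groupP; apply: shift_seriesP; last by rewrite g0 h0.
  exact: local_sep gh.
move=> /(congr1 (fun x : shift_group => coef (sval x) [:: 0%R])) n01.
have : letter_series 1%R 0%R [:: 0%R] = @delta int [:: 0%R] by exact: n01.
by rewrite /letter_series /delta eqxx => /eqP.
Qed.

End TheExample.

Theorem proposition1p8 (R : realType) :
  (highly_transitive abt_group /\
   mixed_identity_free abt_group /\
   ~ acylindrically_hyperbolic R abt_group) /\
  (exists G : groupType,
     [/\ finitely_generated G, mixed_identity_free G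
       & transitivity_degree R G = (1%:E)%E]).
Proof.
split.
  split; first exact: abt_highly_transitive.
  split; first exact: abt_mixed_identity_free.
  exact: abt_not_acylindrically_hyperbolic.
exists shift_group; split.
- exact: generated_group_fg.
- exact: shift_group_mixed_identity_free.
apply: transitivity_degree_one => T act; exact: shift_group_not_two_transitive.
Qed.
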